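(* Let $\kappa\ge1$, let $\mathbf{p}=(p_0,p_1,\dots,p_\kappa)$ be a probability distribution on $\{0,1,\dots,\kappa\}$ with $p_i>0$ for $1\le i\le\kappa$, let $p^*:=\max(p_1,\dots,p_\kappa)$ and suppose $p_0>p^*$. Let $r$ be the number of $i\in\{1,\dots,\kappa\}$ with $p_i=p^*$. Let $(W_x)_{x\ge0}$ be the $\kappa$-color carrier process, with $W_0=\mathbf{0}$, over an i.i.d. sequence $(\xi_x)_{x\in\mathbb{N}}$ with $\mathbb{P}(\xi_x=i)=p_i$. (i) (Convergence) $(W_x)_{x\ge0}$ is an irreducible, aperiodic, positive recurrent Markov chain on $\mathbb{Z}_{\ge0}^\kappa$ with unique stationary distribution $$\pi(n_1,\dots,n_\kappa)=\prod_{i=1}^\kappa\Big(1-\frac{p_i}{p_0}\Big)\Big(\frac{p_i}{p_0}\Big)^{n_i}.$$ Thus, if $\pi_x$ denotes the distribution of $W_x$ and $d_{TV}$ the total variation distance, then $\lim_{x\to\infty}d_{TV}(\pi_x,\pi)=0$. (ii) (Multi-dimensional gambler's ruin) Let $T_1$ be the first return time of $W_x$ to the origin and $h_1:=\max_{0\le x\le T_1}\lVert W_x\rVert_1$. Then there exists a constant $\delta>0$ such that for all $N\ge1$, $$\delta\binom{N+r-1}{r-1}\Big(\frac{p^*}{p_0}\Big)^N\le\mathbb{P}(h_1\ge N)\le C\binom{N+r-1}{r-1}\Big(\frac{p^*}{p_0}\Big)^N,$$ where $C=1$ if $r=\kappa$, and $C=\Big(\frac{p^*}{p^*-p^{(2)}}\Big)^{\kappa-r}$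 if $r<\kappa$, with $p^{(2)}$ the second largest value among $p_1,\dots,p_\kappa$ (the largest value strictly smaller than $p^*$).
   Context: $\mathbb{N}=\{1,2,\dots\}$; $\mathbf{e}_i$ is the $i$-th standard basis vector of $\mathbb{Z}^\kappa$. Given a sequence $\xi=(\xi_x)_{x\in\mathbb{N}}$ in $\{0,\dots,\kappa\}$, the $\kappa$-color carrier process over $\xi$ is the process $(W_x)_{x\ge0}$ on $\mathbb{Z}_{\ge0}^\kappa$, $W_x=(W_x(1),\dots,W_x(\kappa))$, defined as follows. Put $i:=\xi_{x+1}$ if $\xi_{x+1}\in\{1,\dots,\kappa\}$ and $i:=\kappa+1$ if $\xi_{x+1}=0$; let $i_*:=\sup\{1\le j<i: W_x(j)\ge1\}$ with $\sup\emptyset=0$. Then $W_{x+1}-W_x=\mathbf{e}_i-\mathbf{1}(i_*\ne0)\mathbf{e}_{i_*}$ if $1\le i\le\kappa$, and $W_{x+1}-W_x=-\mathbf{1}(i_*\ne0)\mathbf{e}_{i_*}$ if $i=\kappa+1$. *)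

(* Defs.v *)
From mathcomp Require Import all_boot all_order all_algebra.
From mathcomp Require Import all_classical all_reals all_analysis.

Set Implicit Arguments.
Unset Strict Implicit.
Unset Printing Implicit Defensive.

Import Order.TTheory GRing.Theory Num.Theory.

Local Open Scope classical_set_scope.
Local Open Scope ring_scope.

(* Discrete Markov chains on a countable state space S with transition matrix Q. *)
Section MarkovChain.
Context {R : realType} {S : countType}.
Implicit Types (Q : S -> S -> R) (mu : S -> R) (x y : S).

Definition stochastic Q : Prop :=
  (forall x y, 0 <= Q x y) /\
  (forall x, \esum_(y in [set: S]) (Q x y)%:E = 1%E).

(* The Markov property is written without division: it is the usual
   P(X_{n+1} = s_{n+1} | X_0 = s_0, ..., X_n = s_n) = Q(s_n, s_{n+1})
   whenever the conditioning event has positive probability. *)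
Definition markov_chain {d : measure_display} {Omega : measurableType d}
    (P : probability Omega R) (X : nat -> Omega -> S) Q : Prop :=
  [/\ stochastic Q,
      forall n x, measurable (X n @^-1` [set x]) &
      forall n (s : nat -> S),
        P [set w | forall k, (k <= n.+1)%N -> X k w = s k] =
        (P [set w | forall k, (k <= n)%N -> X k w = s k] *
         (Q (s n) (s n.+1))%:E)%E].

Fixpoint nstep Q (n : nat) x y : \bar R :=
  if n is n'.+1
  then \esum_(z in [set: S]) ((Q x z)%:E * nstep Q n' z y)%E
  else if x == y then 1%E else 0%E.

(* first_passage Q n x y is P_x(X_n = y and X_m <> y for 0 < m < n), for n >= 1. *)
Fixpoint first_passage Q (n : nat) x y : \bar R :=
  match n with
  | 0 => 0%E
  | 1 => (Q x y)%:E
  | n'.+1 => \esum_(z in [set~ y]) ((Q x z)%:E * first_passage Q n' z y)%E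
  end.

Definition irreducible_chain Q : Prop :=
  forall x y, exists n, (0 < nstep Q n x y)%E.

(* The only common divisor of {n >= 1 | Q^n(x, x) > 0} is 1. *)
Definition aperiodic_chain Q : Prop :=
  forall x (g : nat),
    (forall n, (0 < n)%N -> (0 < nstep Q n x x)%E -> (g %| n)%N) -> g = 1%N.

(* From every state x, the return time to x is almost surely finite and has
   finite expectation. *)
Definition positive_recurrent Q : Prop :=
  forall x,
    \esum_(n in [set: nat]) first_passage Q n x x = 1%E /\
    (\esum_(n in [set: nat]) (n%:R%:E * first_passage Q n x x) < +oo)%E.

Definition stationary_distribution Q mu : Prop :=
  [/\ forall x, 0 <= mu x,
      \esum_(x in [set: S]) (mu x)%:E = 1%E &
      forall y, \esum_(x in [set: S]) (mu x * Q x y)%:E = (mu y)%:E].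

Definition law {d : measure_display} {Omega : measurableType d}
    (P : probability Omega R) (X : Omega -> S) (A : set S) : \bar R :=
  P (X @^-1` A).

Definition mass mu (A : set S) : \bar R := \esum_(x in A) (mu x)%:E.

Definition tv_dist (m1 m2 : set S -> \bar R) : \bar R :=
  ereal_sup [set `|m1 A - m2 A|%E | A in [set: set S]].

(* First return time of a trajectory to y; +oo if it never returns. *)
Definition return_time (s : nat -> S) y : \bar R :=
  ereal_inf [set (x%:R)%:E | x in [set x : nat | (0 < x)%N /\ s x = y]].

End MarkovChain.

Section IID.
Context {R : realType} {d : measure_display} {Omega : measurableType d}.
Context {E : finType}.

Definition iid (P : probability Omega R) (xi : nat -> Omega -> E) (p : E -> R) :
    Prop :=
  [/\ forall x c, measurable (xi x @^-1` [set c]),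
      forall x c, P (xi x @^-1` [set c]) = (p c)%:E &
      forall (J : seq nat) (A : nat -> set E), uniq J ->
        P [set w | forall x, x \in J -> A x (xi x w)] =
        (\prod_(x <- J) fine (P (xi x @^-1` A x)))%:E].

End IID.

(* Letters 0, ..., kappa are the elements of 'I_kappa.+1. The coordinate
   j : 'I_kappa of a carrier state is the number of balls of color j + 1, which as
   a letter is lift ord0 j. *)
Notation carrier_state kappa := {ffun 'I_kappa -> nat}.

Section Carrier.
Context {kappa : nat}.
Local Notation state := (carrier_state kappa).
Implicit Types (w : state) (c : 'I_kappa.+1).

Definition origin : state := [ffun=> 0%N].

Definition inserted c : nat := if c == ord0 then kappa.+1 else c.

Definition ejected w c : nat :=
  \max_(j < kappa | (j.+1 < inserted c)%N && (1 <= w j)%N) j.+1.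

(* The subtraction never truncates: if ejected w c = j + 1 then w j >= 1. The
   added term vanishes for c = 0, the subtracted one when nothing is ejected. *)
Definition carrier_step w c : state :=
  [ffun j : 'I_kappa =>
     (w j + (j.+1 == inserted c) - (j.+1 == ejected w c))%N].

(* The sequence is indexed from 0: xi x stands for the letter at site x + 1. *)
Fixpoint carrier w0 (xi : nat -> 'I_kappa.+1) (x : nat) : state :=
  if x is x'.+1 then carrier_step (carrier w0 xi x') (xi x') else w0.

Definition norm1 w : nat := \sum_(j < kappa) w j.

End Carrier.

Section CarrierParameters.
Context {R : realType} {kappa : nat}.
Implicit Types (p : 'I_kappa.+1 -> R).

Definition carrier_matrix p (w w' : carrier_state kappa) : R :=
  \sum_(c < kappa.+1 | carrier_step w c == w') p c.

Definition carrier_pi p (n : carrier_state kappa) : R :=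
  \prod_(i < kappa)
    ((1 - p (lift ord0 i) / p ord0) * (p (lift ord0 i) / p ord0) ^+ n i).

Definition pstar p : R := \big[Num.max/0]_(i < kappa) p (lift ord0 i).

Definition mult_pstar p : nat := #|[pred i : 'I_kappa | p (lift ord0 i) == pstar p]|.

Definition psecond p : R :=
  \big[Num.max/0]_(i < kappa | p (lift ord0 i) < pstar p) p (lift ord0 i).

Definition ruin_const p : R :=
  if mult_pstar p == kappa then 1
  else (pstar p / (pstar p - psecond p)) ^+ (kappa - mult_pstar p).

(* Maximum of the l1 norm up to the first return time to the origin; a supremum
   in \bar R, so that trajectories that never return are covered. *)
Definition excursion_height (s : nat -> carrier_state kappa) : \bar R :=
  ereal_sup [set ((norm1 (s x))%:R)%:E | x in
    [set x : nat | ((x%:R)%:E <= return_time (R := R) s origin)%E]].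

End CarrierParameters.

(* Main.v *)
Require Import Defs.
From mathcomp Require Import all_boot all_order all_algebra.
From mathcomp Require Import finmap.
From mathcomp Require Import all_classical all_reals all_analysis.
From mathcomp Require Import zify ring lra.

Set Implicit Arguments.
Unset Strict Implicit.
Unset Printing Implicit Defensive.

Import Order.TTheory GRing.Theory Num.Theory.
Import numFieldNormedType.Exports.

Local Open Scope classical_set_scope.
Local Open Scope ring_scope.

(** The carrier is a random map: each letter c moves every state w to
    carrier_step w c.  Recording also the ejected letter turns one step into a
    bijection (w, c) |-> (w', c') of states times letters, and the weight
    pi(w) p(c) is preserved, because each ball of color i carries the factor
    p_i / p_0 in pi and the letter 0 carries the factor 1.  Summing over the
    letters gives stationarity (carrier_pi_stationary), as for quasi-reversible
    queues.

    A stationary law of full support makes the chain positive recurrent: the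
    pi-average of the probability of not visiting y during n steps decreases by
    pi(y) P_y(T_y > n) when n grows by one, so these quantities have a sum of at
    most 1 (sum_avoid_le, positive_recurrent_stationary).

    Convergence and uniqueness come from driving two carriers by the same
    letters.  The tail sums B_a = w_a + ... + w_kappa evolve by
    B_a -> max(B_a - 1, 0) for the letter 0 and B_a -> max(B_a, B_i + 1) for a
    letter i >= a.  These maps are monotone, so the carrier started at 0 stays
    below the one started at w and has merged with it once the latter reaches 0.
    The distance to equilibrium is therefore at most the pi-average of the
    probability that 0 has not been visited, which tends to 0
    (stationary_near, uncoupled_cvg0).

    For the ruin estimate let u(w) be the probability that the norm reaches N
    before the origin is visited.  This function is harmonic at the states
    different from 0 of norm less than N, and invariance of pi gives the balance
    pi(0) P(h_1 >= N) = sum over |w| = N of pi(w) (1 - E_w u(W_1)):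
    what leaves the origin towards level N equals what leaves level N towards
    the origin (flux_avg, flux_balance).  The last factor is at most 1, and it is
    bounded below uniformly in N and w (escape): the function
    sum_a L^a theta^(B_a), with theta between 1 and p_0 / p^* and L large,
    decreases on average off a finite set, so that after finitely many letters 0
    the carrier has a fair chance of visiting 0 before its norm returns to N.
    Hence P(h_1 >= N) is comparable to
    pi(|w| = N) / pi(0), which is the complete homogeneous symmetric polynomial
    of degree N in the ratios p_i / p_0.  It is the coefficient of X^N in a
    product of geometric polynomials; the r maximal ratios produce the binomial
    coefficient, and the others contribute at most the constant ruin_const
    (prod_geom_ge, prod_geom_le). *)

(** * Averages against a probability on a countable set *)

Lemma esumZl (R : realType) (T : choiceType) (I : set T) (c : R)
    (a : T -> \bar R) : 0 <= c -> (forall i, I i -> (0 <= a i)%E) ->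
  (\esum_(i in I) (c%:E * a i) = c%:E * \esum_(i in I) a i)%E.
Proof.
have le_esumZ (k : R) b : 0 < k -> (forall i, I i -> (0 <= b i)%E) ->
    (\esum_(i in I) (k%:E * b i) <= k%:E * \esum_(i in I) b i)%E.
  move=> k0 b0; apply: ge_ereal_sup => _ [X [finX XI] <-].
  rewrite fsbig_finite//= big_seq -ge0_sume_distrr; last first.
    by move=> i; rewrite in_fset_set// inE => /XI /b0.
  rewrite -big_seq lee_wpmul2l ?lee_fin ?(ltW k0)//.
  by apply: ereal_sup_ubound; exists X => //; rewrite fsbig_finite.
rewrite le_eqVlt => /predU1P[<- a0|c0 a0].
  by rewrite mul0e esum1// => i _; rewrite mul0e.
apply/eqP; rewrite eq_le le_esumZ//=.
have := @le_esumZ c^-1 (fun i => c%:E * a i)%E.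
rewrite invr_gt0 => /(_ c0) h.
rewrite muleC -lee_pdivlMr// muleC; apply: le_trans (h _).
  apply: le_esum => i _; rewrite muleA -EFinM mulVf ?mul1e// gt_eqF//.
by move=> i Ii; rewrite mule_ge0 ?lee_fin ?(ltW c0)// a0.
Qed.

Section Averages.
Context {R : realType} {S : countType}.
Implicit Types (mu g h : S -> R) (x y : S).

Definition in01 g := forall x, 0 <= g x <= 1.

(** Real-valued expectation; meaningful on functions with values in [0, 1],
    where the sum is finite. *)
Definition avg mu g : R := fine (\esum_(x in [set: S]) (mu x * g x)%:E).

Variable mu : S -> R.
Hypotheses (mu_ge0 : forall x, 0 <= mu x)
  (mu1 : \esum_(x in [set: S]) (mu x)%:E = 1%E).

Lemma avgE g : in01 g ->
  \esum_(x in [set: S]) (mu x * g x)%:E = (avg mu g)%:E.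
Proof.
move=> g01; rewrite /avg fineK// fin_numElt; apply/andP; split.
  apply: lt_le_trans (esum_ge0 _); rewrite ?ltNyr// => x _.
  by rewrite lee_fin mulr_ge0//; case/andP: (g01 x).
apply: (@le_lt_trans _ _ 1%E); last exact: ltry.
rewrite -mu1; apply: le_esum => x _; rewrite lee_fin ler_piMr//.
by case/andP: (g01 x).
Qed.

Lemma avg1 : avg mu (fun=> 1) = 1.
Proof.
apply: EFin_inj; rewrite -avgE; last by move=> x; rewrite ler01 lexx.
by rewrite -[RHS]mu1; apply: eq_esum => x _; rewrite mulr1.
Qed.

Lemma le_avg g h : in01 g -> in01 h -> (forall x, g x <= h x) ->
  avg mu g <= avg mu h.
Proof.
move=> g01 h01 gh; rewrite -lee_fin -!avgE//; apply: le_esum => x _.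
by rewrite lee_fin ler_wpM2l.
Qed.

Lemma eq_avg g h : (forall x, g x = h x) -> avg mu g = avg mu h.
Proof. by move=> /funext ->. Qed.

Lemma avg_le1 g : in01 g -> avg mu g <= 1.
Proof.
move=> g01; rewrite -avg1; apply: le_avg => // x; rewrite ?ler01 ?lexx//.
by case/andP: (g01 x).
Qed.

Lemma avg_ge0 g : in01 g -> 0 <= avg mu g.
Proof.
move=> g01; rewrite -lee_fin -avgE//; apply: esum_ge0 => x _.
by rewrite lee_fin mulr_ge0//; case/andP: (g01 x).
Qed.

Lemma avgD g h : in01 g -> in01 h ->
  avg mu (fun x => g x + h x) = avg mu g + avg mu h.
Proof.
move=> g01 h01; rewrite {1}/avg.
rewrite (eq_esum (b := fun x => (mu x * g x)%:E + (mu x * h x)%:E)%E); last first.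
  by move=> x _; rewrite mulrDr EFinD.
rewrite esumD ?avgE//.
- by move=> x _; rewrite lee_fin mulr_ge0//; case/andP: (g01 x).
- by move=> x _; rewrite lee_fin mulr_ge0//; case/andP: (h01 x).
Qed.

Lemma avg_le_add g h k : in01 g -> in01 h -> in01 k ->
  (forall x, g x <= h x + k x) -> avg mu g <= avg mu h + avg mu k.
Proof.
move=> g01 h01 k01 ghk; rewrite -lee_fin EFinD -!avgE// -esumD.
- by apply: le_esum => x _; rewrite -EFinD lee_fin -mulrDr ler_wpM2l.
- by move=> x _; rewrite lee_fin mulr_ge0//; case/andP: (h01 x).
- by move=> x _; rewrite lee_fin mulr_ge0//; case/andP: (k01 x).
Qed.

Lemma avg_cst (a : R) : 0 <= a <= 1 -> avg mu (fun=> a) = a.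
Proof.
move=> a01; have [a0 _] := andP a01; apply: EFin_inj; rewrite -avgE//.
rewrite -[RHS]mule1 -mu1 -esumZl//; last by move=> x _; rewrite lee_fin.
by apply: eq_esum => x _; rewrite mulrC EFinM.
Qed.

Lemma avg_indic (A : set S) :
  (avg mu \1_A)%:E = \esum_(x in A) (mu x)%:E.
Proof.
rewrite -avgE; last by move=> x; rewrite indicE; case: (_ \in _); rewrite ?ler01 lexx.
rewrite [RHS]esum_mkcond; apply: eq_esum => x _; rewrite indicE.
by case: (_ \in _); rewrite ?mulr1 ?mulr0.
Qed.

Lemma avg_point y (a : R) : 0 <= a <= 1 ->
  avg mu (fun x => (x == y)%:R * a) = mu y * a.
Proof.
move=> a01; have [a0 a1] := andP a01.
apply: EFin_inj; rewrite -avgE; last first.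
  by move=> x; case: (x == y); rewrite ?mul1r ?mul0r ?a01// lexx ler01.
rewrite -(@esum_set1 _ _ y (fun x => (mu x * a)%:E)); last by rewrite lee_fin mulr_ge0.
rewrite [RHS]esum_mkcond; apply: eq_esum => x _.
case: (eqVneq x y) => [->|/eqP xy]; first by rewrite mem_set// mul1r.
by rewrite memNset// mul0r mulr0.
Qed.

(** Dominated convergence: outside a finite set carrying all but e / 2 of the mass
    the functions are bounded by 1, and on the finite set they tend to 0. *)
Lemma avg_cvg0 (g : nat -> S -> R) : (forall n, in01 (g n)) ->
  (forall x, g n x @[n --> \oo] --> 0) -> avg mu (g n) @[n --> \oo] --> 0.
Proof.
move=> g01 gx; apply/cvgrPdist_le => e e0.
have e20 : 0 < e / 2 by rewrite divr_gt0.
have [X [finX _] /ltW Xe] : exists2 X, fsets [set: S] X &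
    ((1 - e / 2)%:E < \sum_(x \in X) (mu x)%:E)%E.
  have /ereal_sup_gt[_ [X XS <-] Xe] : ((1 - e / 2)%:E <
      \esum_(x in [set: S]) (mu x)%:E)%E.
    by rewrite mu1 lte_fin ltrBlDr ltrDl.
  by exists X.
have tail n : avg mu (g n) <= \sum_(x <- fset_set X) mu x * g n x + e / 2.
  have XT : (\esum_(x in X) (mu x)%:E + \esum_(x in ~` X) (mu x)%:E = 1)%E.
    rewrite -mu1 (esumID X [set: S]) ?setTI//.
    by move=> x _; rewrite lee_fin.
  have XE (h : S -> R) : (forall x, 0 <= h x) ->
      (\esum_(x in X) (h x)%:E = (\sum_(x <- fset_set X) h x)%:E)%E.
    move=> h0; rewrite esum_fset//; last by move=> i _; rewrite lee_fin.
    by rewrite fsbig_finite//= sumEFin.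
  have CX : (\esum_(x in ~` X) (mu x)%:E <= (e / 2)%:E)%E.
    move: Xe XT; rewrite fsbig_finite//= sumEFin XE// lee_fin.
    case: (\esum_(x in ~` X) (mu x)%:E)%E => [r||]//=.
    by move=> h [] h1; rewrite lee_fin; lra.
  rewrite -lee_fin -avgE// (esumID X [set: S])// ?setTI.
    rewrite XE; last by move=> x; rewrite mulr_ge0//; case/andP: (g01 n x).
    rewrite EFinD leeD//; apply: le_trans CX; apply: le_esum => x _.
    by rewrite lee_fin ler_piMr//; case/andP: (g01 n x).
  by move=> x _; rewrite lee_fin mulr_ge0//; case/andP: (g01 n x).
have sum_cvg (r : seq S) : (\sum_(x <- r) mu x * g n x) @[n --> \oo] --> 0.
  elim: r => [|x r IH]; first by under eq_fun do rewrite big_nil; exact: cvg_cst.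
  under eq_fun do rewrite big_cons.
  have mux : mu x @[_ --> \oo] --> mu x by exact: cvg_cst.
  have := cvgD (cvgM mux (gx x)) IH.
  by rewrite mulr0 addr0; exact.
have /cvgrPdist_le/(_ _ e20) := sum_cvg (fset_set X); apply: filterS => n /=.
have s0 : 0 <= \sum_(x <- fset_set X) mu x * g n x.
  by apply: sumr_ge0 => x _; rewrite mulr_ge0//; case/andP: (g01 n x).
rewrite !sub0r !normrN !ger0_norm ?avg_ge0// => h.
by have := tail n; lra.
Unshelve. all: by end_near. Qed.

End Averages.

(** * Markov chains driven by random maps *)

Section RandomMap.
Context {R : realType} {S : countType} {E : finType}.
Variables (p : E -> R) (step : S -> E -> S).
Hypotheses (p_ge0 : forall c, 0 <= p c) (p_sum1 : \sum_c p c = 1).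
Implicit Types (f g : S -> R) (x y z : S).

(** Transition matrix of the random map; it is convertible to carrier_matrix when
    the map is carrier_step. *)
Definition kernel x y : R := \sum_(c | step x c == y) p c.

(** The backward operator f |-> E_x f(X_1).  It is a finite sum, unlike the
    action of the kernel on measures, so iterating it avoids infinite sums. *)
Definition onestep f x : R := \sum_c p c * f (step x c).

Lemma le_onestep f g : (forall x, f x <= g x) -> forall x, onestep f x <= onestep g x.
Proof. by move=> fg x; apply: ler_sum => c _; rewrite ler_wpM2l. Qed.

Lemma onestep_cst (a : R) x : onestep (fun=> a) x = a.
Proof. by rewrite /onestep -mulr_suml p_sum1 mul1r. Qed.

Lemma onestep_in01 f : in01 f -> in01 (onestep f).
Proof.
move=> f01 x; rewrite -[X in X <= _ <= _](onestep_cst 0 x).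
by rewrite -[X in _ <= _ <= X](onestep_cst 1 x) !le_onestep// => y; case/andP: (f01 y).
Qed.

Lemma onestep_ge_step f x c : (forall y, 0 <= f y) -> p c * f (step x c) <= onestep f x.
Proof.
move=> f0; rewrite /onestep (bigD1 c)//= lerDl; apply: sumr_ge0 => i _.
exact: mulr_ge0.
Qed.

Lemma esum_kernel (g : S -> \bar R) x : (forall z, 0 <= g z)%E ->
  (\esum_(z in [set: S]) ((kernel x z)%:E * g z) =
   \sum_c (p c)%:E * g (step x c))%E.
Proof.
move=> g0; transitivity
    (\esum_(z in [set: S]) \sum_c (if step x c == z then (p c)%:E * g z else 0))%E.
  apply: eq_esum => z _; rewrite /kernel -sumEFin ge0_sume_distrl.
    by rewrite big_mkcond.
  by move=> c _; rewrite lee_fin.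
rewrite esum_sum; last by move=> z c _ _; case: ifP => // _; rewrite mule_ge0// lee_fin.
apply: eq_bigr => c _; have <- := @esum_set1 _ _ (step x c) (fun z => (p c)%:E * g z)%E.
  rewrite [RHS]esum_mkcond; apply: eq_esum => z _.
  case: (eqVneq (step x c) z) => [<-|/eqP h]; first by rewrite mem_set.
  by rewrite memNset//= => /esym.
by rewrite mule_ge0// lee_fin.
Qed.

Lemma esum_kernelE f x : (forall z, 0 <= f z) ->
  (\esum_(z in [set: S]) ((kernel x z)%:E * (f z)%:E) = (onestep f x)%:E)%E.
Proof.
move=> f0; rewrite esum_kernel; last by move=> z; rewrite lee_fin.
by rewrite /onestep -sumEFin; apply: eq_bigr => c _; rewrite EFinM.
Qed.

Lemma kernel_ge0 x y : 0 <= kernel x y.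
Proof. exact: sumr_ge0. Qed.

Lemma kernel_stochastic : stochastic kernel.
Proof.
split; first exact: kernel_ge0.
move=> x; have /= := @esum_kernelE (fun=> 1) x (fun=> ler01).
by rewrite onestep_cst => <-; apply: eq_esum => z _; rewrite mule1.
Qed.

Lemma iter_onestep_in01 n f : in01 f -> in01 (iter n onestep f).
Proof. by move=> f01; elim: n => // n IH; exact: onestep_in01. Qed.

Lemma in01_eq y : in01 (fun x => (x == y)%:R : R).
Proof. by move=> x; case: (x == y); rewrite ?ler01 lexx. Qed.

Lemma nstepE n x y :
  nstep kernel n x y = (iter n onestep (fun z => (z == y)%:R) x)%:E.
Proof.
elim: n x => [|n IH] x; first by rewrite /=; case: (x == y).
rewrite /= (eq_esum (fun z _ => congr1 _ (IH z))) esum_kernelE// => z.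
by have /andP[] := iter_onestep_in01 n (in01_eq y) z.
Qed.

(** A word of letters of positive probability leading from x to y witnesses that
    y can be reached from x. *)
Lemma nstep_gt0 (s : seq E) x y : (forall c, c \in s -> 0 < p c) ->
  foldl step x s = y -> (0 < nstep kernel (size s) x y)%E.
Proof.
rewrite nstepE lte_fin; elim: s x => [|c s IH] x ps /=; first by move=> ->; rewrite eqxx.
move=> /IH h; apply: lt_le_trans (onestep_ge_step _ c _).
  rewrite mulr_gt0 ?ps ?mem_head//; apply: h => i si.
  by rewrite ps// inE si orbT.
by move=> z; have /andP[] := iter_onestep_in01 (size s) (in01_eq y) z.
Qed.

(** P_x(X_1, ..., X_n all differ from y).  Time 0 is not tested, so that
    avoid y n y is the tail P_y(T_y > n) of the return time. *)
Fixpoint avoid y n x : R :=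
  if n is n'.+1 then onestep (fun z => (z != y)%:R * avoid y n' z) x else 1.

Lemma avoid_in01 y n : in01 (avoid y n).
Proof.
elim: n => [|n IH] x; first by rewrite ler01 lexx.
apply: onestep_in01 => z; case: (z != y); rewrite ?mul1r//.
by rewrite mul0r lexx ler01.
Qed.

Lemma avoid_ge0 y n x : 0 <= avoid y n x.
Proof. by case/andP: (avoid_in01 y n x). Qed.

Lemma in01_neqM y f : in01 f -> in01 (fun z => (z != y)%:R * f z).
Proof.
by move=> f01 x; case: (x != y); rewrite ?mul1r// mul0r lexx ler01.
Qed.

Lemma avoid_noninc y n x : avoid y n.+1 x <= avoid y n x.
Proof.
elim: n x => [|n IH] x; first by case/andP: (avoid_in01 y 1 x).
by apply: le_onestep => z; rewrite ler_wpM2l// IH.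
Qed.

(** A first visit at time n + 1 is an avoidance up to time n that fails at time
    n + 1. *)
Lemma first_passageE n x y :
  first_passage kernel n.+1 x y = (avoid y n x - avoid y n.+1 x)%:E.
Proof.
elim: n x => [|n IH] x.
  congr EFin; rewrite /= -[X in X - _](onestep_cst 1 x) /onestep -sumrB /kernel big_mkcond.
  apply: eq_bigr => c _.
  by case: (_ == y); rewrite /= ?mulr1 ?mulr0 ?subrr ?subr0.
rewrite -[LHS]/(\esum_(z in [set~ y])
    ((kernel x z)%:E * first_passage kernel n.+1 z y)%E).
rewrite esum_mkcond; transitivity (\esum_(z in [set: S])
  ((kernel x z)%:E * ((z != y)%:R * (avoid y n z - avoid y n.+1 z))%:E)%E).
  apply: eq_esum => z _; rewrite IH; case: (eqVneq z y) => [->|/eqP h].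
    by rewrite memNset/= ?mul0r ?mule0//; apply; rewrite /= eqxx.
  by rewrite mem_set//= mul1r.
rewrite esum_kernelE; last first.
  by move=> z; rewrite mulr_ge0// subr_ge0 avoid_noninc.
by congr EFin; rewrite /= /onestep -sumrB; apply: eq_bigr => c _; rewrite -mulrBr -mulrBr.
Qed.

Variable mu : S -> R.
Hypothesis mu_st : stationary_distribution kernel mu.

Let mu_ge0 x : 0 <= mu x. Proof. by case: mu_st. Qed.
Let mu1 : \esum_(x in [set: S]) (mu x)%:E = 1%E. Proof. by case: mu_st. Qed.

(** Invariance in dual form: a stationary law gives the same average to f and to
    its one-step expectation, by exchanging the two sums. *)
Lemma avg_onestep f : in01 f -> avg mu (onestep f) = avg mu f.
Proof.
move=> f01; have f0 z : 0 <= f z by case/andP: (f01 z).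
have k0 x y : (0 <= (mu x * kernel x y)%:E)%E.
  by rewrite lee_fin mulr_ge0// kernel_ge0.
apply: EFin_inj; rewrite -!avgE//; last exact: onestep_in01.
transitivity (\esum_(x in [set: S]) \esum_(y in [set: S])
    (mu x * kernel x y * f y)%:E).
  apply: eq_esum => x _; rewrite EFinM -esum_kernelE// -esumZl//.
    by apply: eq_esum => y _; rewrite -!EFinM mulrA.
  by move=> y _; rewrite -EFinM lee_fin mulr_ge0// kernel_ge0.
rewrite esum_esum; last by move=> x y _ _; rewrite EFinM mule_ge0// lee_fin.
rewrite (reindex_esum ([set: S] `*`` (fun=> [set: S])) _ (fun k => (k.2, k.1)))/=; last first.
  split; first by move=> [].
    by move=> [? ?] [? ?] _ _ /= [-> ->].
  by move=> [a b] _; exists (b, a).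
rewrite -(esum_esum (J := fun=> [set: S]) (a := fun y x => (mu x * kernel x y * f y)%:E)).
  apply: eq_esum => y _; case: mu_st => _ _ st.
  rewrite mulrC EFinM -st -esumZl//.
  by apply: eq_esum => x _; rewrite -EFinM mulrC.
by move=> x y _ _; rewrite EFinM mule_ge0// lee_fin.
Qed.

Lemma avg_iter_onestep n f : in01 f -> avg mu (iter n onestep f) = avg mu f.
Proof.
by move=> f01; elim: n => //= n <-; rewrite avg_onestep//; exact: iter_onestep_in01.
Qed.

(** Under the stationary law, avoiding y at times 1, ..., n + 1 is as likely as
    avoiding it at times 0, ..., n; the difference with avoiding it at times
    1, ..., n only is the event that the chain starts at y. *)
Lemma avg_avoid y n :
  avg mu (avoid y n) = avg mu (avoid y n.+1) + mu y * avoid y n y.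
Proof.
rewrite -[avoid y n.+1]/(onestep _) avg_onestep; last exact/in01_neqM/avoid_in01.
rewrite -(avg_point mu_ge0) ?avoid_in01// -avgD//.
- apply: eq_avg => x; case: (eqVneq x y) => [->|_].
    by rewrite mul0r add0r mul1r.
  by rewrite mul1r mul0r addr0.
- exact/in01_neqM/avoid_in01.
- by move=> x; case: (x == y); rewrite ?mul1r ?mul0r ?avoid_in01// lexx ler01.
Qed.

(** Kac's inequality: telescoping avg_avoid bounds the truncated mean return time
    to y by 1 / mu y. *)
Lemma sum_avoid_le y n : mu y * \sum_(i < n) avoid y i y <= 1.
Proof.
have <- := avg1 mu_ge0 mu1.
suff -> : avg mu (avoid y 0) = avg mu (avoid y n) + mu y * \sum_(i < n) avoid y i y.
  by rewrite lerDr avg_ge0//; exact: avoid_in01.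
elim: n => [|n ->]; first by rewrite big_ord0 mulr0 addr0.
by rewrite avg_avoid big_ord_recr/= mulrDr addrAC addrA.
Qed.

Lemma avoid_cvg0 y : 0 < mu y -> avoid y n y @[n --> \oo] --> 0.
Proof.
move=> muy; apply: (@cvg_series_cvg_0 _ R^o).
apply: nondecreasing_is_cvgn.
  by apply/nondecreasing_seqP => n; rewrite /series/= big_nat_recr//= lerDl avoid_ge0.
exists (mu y)^-1 => _ [n _ <-].
rewrite /series/= big_mkord -[leRHS]mul1r ler_pdivlMr// mulrC.
exact: sum_avoid_le.
Qed.

(** The tails of the return time are summable by Kac's inequality.  Hence they
    tend to 0, which gives a finite return time, and summation by parts bounds
    the partial sums of the mean return time. *)
Lemma positive_recurrent_stationary :
  (forall y, 0 < mu y) -> positive_recurrent kernel.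
Proof.
move=> mu0 y.
have fpE : forall n, first_passage kernel n.+1 y y =
  (avoid y n y - avoid y n.+1 y)%:E by move=> n; exact: first_passageE.
have fp0 n : (0 <= first_passage kernel n y y)%E.
  by case: n => [//|n]; rewrite fpE lee_fin subr_ge0 avoid_noninc.
rewrite -nneseries_esumT// -nneseries_esumT; last first.
  by move=> n; rewrite mule_ge0// lee_fin.
have telesc n : (\sum_(0 <= i < n.+1) first_passage kernel i y y =
    (1 - avoid y n y)%:E)%E.
  rewrite big_nat_recl// [X in (X + _)%E]/= add0e; elim: n => [|n IH].
    by rewrite big_nil subrr.
  by rewrite big_nat_recr// IH fpE; apply: (etrans (esym (EFinD _ _))); congr EFin; ring.
have telesc1 n : (\sum_(0 <= i < n.+1) (i%:R%:E * first_passage kernel i y y) =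
    (\sum_(i < n) avoid y i y - n%:R * avoid y n y)%:E)%E.
  rewrite big_nat_recl// [X in (X + _)%E]/= mul0e add0e; elim: n => [|n IH].
    by rewrite big_nil big_ord0 mul0r subrr.
  rewrite big_nat_recr// IH fpE -EFinM; apply: (etrans (esym (EFinD _ _))).
  by rewrite big_ord_recr -natr1; congr EFin; rewrite [RHS]addrAC -/(avoid y n.+1 y); ring.
split.
  apply/cvg_lim => //; rewrite -(cvg_shiftn 1)/=.
  under eq_fun do rewrite addn1 telesc.
  apply: cvg_EFin; first by apply: nearW.
  rewrite -[X in _ --> X]subr0; apply: cvgB; first exact: cvg_cst.
  exact: avoid_cvg0.
apply: (@le_lt_trans _ _ ((mu y)^-1)%:E); last exact: ltry.
apply: lime_le; first by apply: is_cvg_nneseries => n _ _; rewrite mule_ge0// lee_fin.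
apply: nearW => -[|n].
  by rewrite big_nil lee_fin invr_ge0 ltW.
rewrite telesc1 lee_fin; apply: (@le_trans _ _ (\sum_(i < n) avoid y i y)).
  by rewrite gerBl mulr_ge0// avoid_ge0.
by rewrite -[leRHS]mul1r ler_pdivlMr// mulrC; exact: sum_avoid_le.
Qed.

End RandomMap.

(** * One step of the carrier *)

Section Step.
Context {kappa : nat}.
Local Notation state := (carrier_state kappa).
Implicit Types (w v : state) (c : 'I_kappa.+1) (i j : 'I_kappa).
Local Open Scope nat_scope.

Lemma ltn_ejected a w c :
  (a < ejected w c) = [exists j : 'I_kappa, [&& a <= j, j.+1 < inserted c & 0 < w j]].
Proof.
rewrite ltnNge; apply/idP/existsP => [/bigmax_leqP h|[j /and3P[aj jc wj]]].
  apply/existsP; apply: contra_notT h => /existsPn h j /andP[jc wj].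
  by rewrite ltnNge; apply: contraT => /negPn aj; have := h j; rewrite aj jc wj.
apply/negP => /bigmax_leqP/(_ j); rewrite jc wj => /(_ isT).
by rewrite ltnNge aj.
Qed.

Lemma ejected_lt w c : ejected w c < inserted c.
Proof.
have ins0 : 0 < inserted c by rewrite /inserted; case: eqP => // /eqP; case: c => [[]].
rewrite -(prednK ins0) ltnS; apply/bigmax_leqP => j /andP[jc _].
by rewrite -ltnS (prednK ins0).
Qed.

Lemma inserted_le c : inserted c <= kappa.+1.
Proof. by rewrite /inserted; case: eqP => // _; apply: ltnW. Qed.

Lemma inserted0 : inserted (ord0 : 'I_kappa.+1) = kappa.+1.
Proof. by []. Qed.

Lemma inserted_lift i : inserted (lift ord0 i) = i.+1.
Proof. by rewrite /inserted. Qed.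

Lemma ejected_gt0 j w c : j.+1 == ejected w c -> 0 < w j.
Proof.
move=> /eqP jE; have := ltn_ejected j w c; rewrite -jE ltnSn.
case/esym/existsP=> k /and3P[jk kc wk].
have : k < ejected w c by rewrite ltn_ejected; apply/existsP; exists k; rewrite leqnn kc.
by rewrite -jE ltnS => kj; have -> : j = k by apply: val_inj; apply/eqP; rewrite eqn_leq jk.
Qed.

(** Balls are conserved color by color, in a form free of subtraction. *)
Lemma carrier_stepE w c j :
  carrier_step w c j + (j.+1 == ejected w c) = w j + (j.+1 == inserted c).
Proof.
rewrite ffunE; case: (eqVneq j.+1 (ejected w c)) => [jE|_]; last by lia.
by have := @ejected_gt0 j w c; rewrite jE eqxx => /(_ isT) wj; lia.
Qed.

(** The ejected ball as a letter, with 0 for no ejection, so that one step maps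
    states times letters to itself. *)
Definition out w c : 'I_kappa.+1 := inord (ejected w c).

Lemma outE w c : out w c = ejected w c :> nat.
Proof. by rewrite inordK// (leq_trans (ejected_lt w c)) ?inserted_le. Qed.

Lemma inserted_inj : injective (@inserted kappa).
Proof.
move=> c c'; rewrite /inserted; case: eqP => [->|_]; case: eqP => [->|_] // e.
- by have := ltn_ord c'; rewrite -e ltnn.
- by have := ltn_ord c; rewrite e ltnn.
- exact: val_inj.
Qed.

(** The inserted letter can be read off the new state: between the ejected color
    and the inserted one the carrier is empty, so the inserted color is the
    first one present above the ejected color. *)
Lemma step_out_inj : injective (fun x : state * 'I_kappa.+1 =>
  (carrier_step x.1 x.2, out x.1 x.2)).
Proof.
move=> [w c] [w' c'] /= [se oe].
have {}oe : ejected w c = ejected w' c' by rewrite -!outE oe.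
have wlog_lt w1 c1 w2 c2 : carrier_step w1 c1 = carrier_step w2 c2 ->
    ejected w1 c1 = ejected w2 c2 -> ~~ (inserted c1 < inserted c2).
  move=> s12 o12; apply/negP => lt12.
  have c1k : (inserted c1).-1 < kappa.
    by have := inserted_le c2; have := ejected_lt w1 c1; lia.
  have c1E : (Ordinal c1k).+1 = inserted c1 by have := ejected_lt w1 c1; rewrite /=; lia.
  have h1 := carrier_stepE w1 c1 (Ordinal c1k).
  have h2 := carrier_stepE w2 c2 (Ordinal c1k).
  move: h1 h2; rewrite c1E s12 o12 eqxx (ltn_eqF lt12).
  have -> : (inserted c1 == ejected w2 c2) = false.
    by have := ejected_lt w1 c1; rewrite o12 eq_sym => /ltn_eqF.
  move=> h1 h2; have w2p : 0 < w2 (Ordinal c1k) by lia.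
  have : (inserted c1).-1 < ejected w2 c2.
    by rewrite ltn_ejected; apply/existsP; exists (Ordinal c1k); rewrite c1E lt12 w2p leqnn.
  by have := ejected_lt w1 c1; rewrite o12; lia.
have ie : inserted c = inserted c'.
  apply/eqP; rewrite eqn_leq; apply/andP; split; rewrite leqNgt.
    exact: (wlog_lt w' c' w c).
  exact: (wlog_lt w c w' c').
have ce : c = c' by exact: inserted_inj.
congr pair => //; apply/ffunP => j.
by have := carrier_stepE w c j; have := carrier_stepE w' c' j; rewrite se oe ie => -> /addIn.
Qed.

(** Undoing a step: insert back the ball o and take out the first color present
    in v above o, or no ball at all when there is none. *)
Lemma step_out_surj v o : exists w c, carrier_step w c = v /\ out w c = o.
Proof.
have [c [co vc cmin]] : exists c, [/\ o < inserted c,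
   (forall j : 'I_kappa, j.+1 = inserted c -> 0 < v j) &
   (forall j : 'I_kappa, o <= j -> j.+1 < inserted c -> v j = 0)].
  case: (pickP [pred j : 'I_kappa | (o < j.+1) && (0 < v j)]) => [j0 j0P|none].
    case: (arg_minnP val j0P) => j /andP[/= oj vj] jmin.
    exists (lift ord0 j); rewrite inserted_lift; split=> //.
    - by move=> k [/val_inj ->].
    - move=> k ok kj; apply/eqP; rewrite -leqn0 leqNgt; apply/negP => vk.
      by have := jmin k; rewrite /= ltnS ok vk => /(_ isT); lia.
  exists ord0; split; first exact: ltn_ord.
    by move=> j; rewrite inserted0 => -[] jk; have := ltn_ord j; rewrite jk ltnn.
  by move=> j oj _; apply/eqP; rewrite -leqn0 leqNgt; have := none j; rewrite /= ltnS oj /= => ->.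
pose w : state := [ffun j => v j + (j.+1 == o :> nat) - (j.+1 == inserted c)].
have wE j : w j + (j.+1 == inserted c) = v j + (j.+1 == o :> nat).
  by rewrite ffunE; case: (eqVneq j.+1 (inserted c)) => [/vc|_]; lia.
have ejE : ejected w c = o.
  apply/eqP; rewrite eqn_leq; apply/andP; split.
    rewrite leqNgt ltn_ejected; apply/existsP => -[j /and3P[oj jc wj]].
    have := wE j; rewrite (cmin j)//; first by case: eqP; case: eqP => //; lia.
  case: (posnP o) => [->//|o0]; rewrite -{1}(prednK o0) ltn_ejected.
  have o1 : o.-1 < kappa by have := ltn_ord o; lia.
  apply/existsP; exists (Ordinal o1) => /=; rewrite leqnn prednK// co/=.
  by have := wE (Ordinal o1); rewrite /= prednK// eqxx (ltn_eqF co); lia.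
exists w, c; split; last by apply: val_inj; rewrite /= outE.
apply/ffunP => j; have := carrier_stepE w c j; rewrite ejE wE; exact: addIn.
Qed.

(** Colors are counted from 0 here: tail_sum 0 is the norm. *)
Definition tail_sum a w := \sum_(j < kappa | a <= j) w j.

Lemma tail_sum_step a w c : tail_sum a (carrier_step w c) + (a < ejected w c) =
  tail_sum a w + (a < inserted c <= kappa).
Proof.
have indic m : \sum_(j < kappa | a <= j) (j.+1 == m) = (a < m <= kappa).
  case: (boolP (a < m <= kappa)) => [/andP[am mk]|h].
    have mk' : m.-1 < kappa by lia.
    rewrite (bigD1 (Ordinal mk'))/=; last by lia.
    rewrite big1 ?addn0 ?prednK ?eqxx//; first by lia.
    move=> j /andP[aj]; rewrite -val_eqE/= => jm; apply/eqP; rewrite eqb0; lia.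
  rewrite big1// => j aj; apply/eqP; rewrite eqb0; apply/negP => /eqP jm.
  by move: h; rewrite -jm ltnS aj ltn_ord.
have ek : ejected w c <= kappa.
  by rewrite -ltnS (leq_trans (ejected_lt w c))// inserted_le.
have -> : (a < ejected w c) = (a < ejected w c <= kappa) by rewrite ek andbT.
rewrite -!indic /tail_sum -!big_split/=.
by apply: eq_bigr => j _; exact: carrier_stepE.
Qed.

Lemma tail_sum_gt0 a w : (0 < tail_sum a w) = [exists j : 'I_kappa, (a <= j) && (0 < w j)].
Proof.
rewrite lt0n sum_nat_eq0 negb_forall_in; apply: eq_existsb => j.
by rewrite lt0n.
Qed.

(** The letter 0 removes the ball of the largest color present, which lies in
    every nonempty tail. *)
Lemma tail_sum_step0 a w : tail_sum a (carrier_step w ord0) = (tail_sum a w).-1.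
Proof.
have := tail_sum_step a w ord0; rewrite inserted0 ltnn andbF addn0.
have -> : (a < ejected w ord0) = (0 < tail_sum a w).
  rewrite ltn_ejected tail_sum_gt0; apply: eq_existsb => j.
  by rewrite inserted0 ltnS ltn_ord.
by case: ltnP; lia.
Qed.

Lemma tail_sum_lift_lt a w i : i < a ->
  tail_sum a (carrier_step w (lift ord0 i)) = tail_sum a w.
Proof.
move=> ia; have := tail_sum_step a w (lift ord0 i); rewrite inserted_lift.
by have := ejected_lt w (lift ord0 i); rewrite inserted_lift; lia.
Qed.

(** Inserting color i keeps the tail sum from a when a color in [a, i) is present
    to be ejected, that is, when the tail sums from a and i differ; otherwise it
    increases that sum by one.  Both cases are the maximum below. *)
Lemma tail_sum_lift_ge a w i : a <= i ->
  tail_sum a (carrier_step w (lift ord0 i)) = maxn (tail_sum a w) (tail_sum i w).+1.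
Proof.
move=> ai; have := tail_sum_step a w (lift ord0 i); rewrite inserted_lift ltnS ai ltn_ord.
have tE : tail_sum a w = \sum_(j < kappa | (a <= j) && (j < i)) w j + tail_sum i w.
  rewrite /tail_sum (bigID (fun j : 'I_kappa => j < i))/=; congr addn.
  by apply: eq_bigl => j; lia.
have -> : (a < ejected w (lift ord0 i)) = (0 < \sum_(j < kappa | (a <= j) && (j < i)) w j).
  rewrite ltn_ejected inserted_lift lt0n sum_nat_eq0 negb_forall_in.
  by apply: eq_existsb => j; rewrite ltnS lt0n andbA.
by rewrite tE; case: ltnP; lia.
Qed.

Lemma norm1E w : norm1 w = tail_sum 0 w.
Proof. by []. Qed.

Lemma tail_sum_le_norm1 a w : tail_sum a w <= norm1 w.
Proof.
rewrite norm1E {2}/tail_sum (bigID (fun j : 'I_kappa => a <= j))/=.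
by rewrite leq_addr.
Qed.

Lemma norm1_eq0 w : (norm1 w == 0) = (w == origin).
Proof.
rewrite /norm1 sum_nat_eq0; apply/forallP/eqP => [h|-> j]; last by rewrite ffunE.
by apply/ffunP => j; rewrite ffunE; apply/eqP; exact: h.
Qed.

Lemma norm1_origin : norm1 (origin : state) = 0.
Proof. by apply/eqP; rewrite norm1_eq0. Qed.

Lemma norm1_step0 w : norm1 (carrier_step w ord0) = (norm1 w).-1.
Proof. by rewrite !norm1E tail_sum_step0. Qed.

(** The order on states that the dynamics preserves; it compares all tail sums
    and implies the comparison of norms. *)
Definition tail_le v w := forall a, tail_sum a v <= tail_sum a w.

Lemma tail_le_step v w c : tail_le v w ->
  tail_le (carrier_step v c) (carrier_step w c).
Proof.
move=> vw a; case: (unliftP ord0 c) => [i|] ->.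
  case: (ltnP i a) => ia; first by rewrite !tail_sum_lift_lt.
  by rewrite !tail_sum_lift_ge// geq_max !leq_max vw ltnS vw orbT.
by rewrite !tail_sum_step0; have := vw a; lia.
Qed.

Lemma tail_le_origin w : tail_le origin w.
Proof. by move=> a; rewrite /tail_sum big1// => j _; rewrite ffunE. Qed.

Lemma tail_le_eq_origin v : tail_le v origin -> v = origin.
Proof.
move=> /(_ 0); rewrite -!norm1E norm1_origin leqn0 norm1_eq0.
by move/eqP.
Qed.

(** Every nonempty state arises from a smaller one by an insertion without
    ejection: take its smallest color out. *)
Lemma ex_insert w : w != origin -> exists v i,
  carrier_step v (lift ord0 i) = w /\ (norm1 v).+1 = norm1 w.
Proof.
move=> w0; have : 0 < norm1 w by rewrite lt0n norm1_eq0.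
rewrite norm1E tail_sum_gt0 => /existsP[j0 /= j0P].
case: (@arg_minnP _ j0 (fun j => 0 < w j) val j0P) => i wi imin.
pose v : state := [ffun j => w j - (j == i)]; exists v, i.
have vE j : v j + (j == i) = w j by rewrite ffunE; case: eqP => [->|]; lia.
have e0 : ejected v (lift ord0 i) = 0.
  apply/eqP; rewrite -leqn0 leqNgt ltn_ejected inserted_lift.
  apply/existsP => -[j /and3P[_ ji vj]]; have : 0 < w j by rewrite -vE; lia.
  by move=> /imin /= ij; move: ji; rewrite ltnS ltnNge ij.
split.
  apply/ffunP => j; have := carrier_stepE v (lift ord0 i) j.
  by rewrite e0 addn0 inserted_lift -vE eqSS => ->.
have := tail_sum_step 0 v (lift ord0 i); rewrite e0 inserted_lift ltn_ord addn0 -norm1E.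
rewrite -norm1E addn1 => <-; congr norm1.
apply/ffunP => j; have := carrier_stepE v (lift ord0 i) j.
by rewrite e0 addn0 inserted_lift -vE eqSS => ->.
Qed.

End Step.

(** * The product measure is stationary *)

Lemma esum_finType (R : realType) (T : finType) (a : T -> \bar R) :
  (forall t, 0 <= a t)%E -> (\esum_(t in [set: T]) a t = \sum_t a t)%E.
Proof.
move=> a0; rewrite esum_fset//; last exact: finite_finset.
rewrite (fsbigE (index_enum T)) ?index_enum_uniq//.
  by apply: eq_bigl => t; rewrite in_setT.
by move=> t _; rewrite mem_index_enum.
Qed.

Section Box.
Context {R : realType} {kappa : nat}.
Local Notation state := (carrier_state kappa).
Implicit Types (w : state) (a : state -> R).

Definition box M : set state := [set w | forall i, (w i <= M)%N].

Definition unbox M (f : {ffun 'I_kappa -> 'I_M.+1}) : state := [ffun i => f i : nat].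

(** Sums over a box are sums over functions between finite types, to which
    distributivity of products over sums applies. *)
Lemma esum_box M a : (forall w, 0 <= a w) ->
  (\esum_(w in box M) (a w)%:E =
   (\sum_(f : {ffun 'I_kappa -> 'I_M.+1}) a (unbox f))%:E)%E.
Proof.
move=> a0; have -> : box M = (@unbox M) @` [set: _].
  apply/seteqP; split=> [w wM|_ [f _ <-] i]; last by rewrite ffunE -ltnS.
  exists [ffun i => inord (w i)] => //; apply/ffunP => i.
  by rewrite !ffunE inordK// ltnS; exact: wM.
rewrite esum_image; last first.
  move=> f g _ _ /ffunP fg; apply/ffunP => i; apply: val_inj.
  by have := fg i; rewrite !ffunE.
by rewrite esum_finType ?sumEFin// => f; rewrite lee_fin.
Qed.

Lemma finite_sub_box (X : set state) : finite_set X -> exists M, X `<=` box M.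
Proof.
move=> finX; exists (\max_(w <- fset_set X) norm1 w)%N => w Xw i.
have wX : w \in fset_set X by rewrite in_fset_set// inE.
apply: leq_trans (leq_bigmax_seq _ wX isT).
by rewrite /norm1 (bigD1 i)//= leq_addr.
Qed.

End Box.

Section Stationary.
Context {R : realType} {kappa : nat}.
Local Notation state := (carrier_state kappa).
Variables (p : 'I_kappa.+1 -> R).
Hypotheses (p_ge0 : forall c, 0 <= p c) (p_sum1 : \sum_(c < kappa.+1) p c = 1)
  (p_gt0 : forall i : 'I_kappa, 0 < p (lift ord0 i)) (hp : pstar p < p ord0).
Implicit Types (w v : state) (c : 'I_kappa.+1) (i : 'I_kappa).

Local Notation rho i := (p (lift ord0 i) / p ord0).

Lemma le_pstar i : p (lift ord0 i) <= pstar p.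
Proof. by rewrite /pstar (bigD1 i)//= le_max lexx. Qed.

Lemma pstar_ge0 : 0 <= pstar p.
Proof. by rewrite /pstar; elim/big_ind: _ => // x y x0 y0; rewrite le_max x0. Qed.

Lemma p0_gt0 : 0 < p ord0.
Proof. exact: le_lt_trans pstar_ge0 hp. Qed.

Lemma letter_gt0 c : 0 < p c.
Proof. by case: (unliftP ord0 c) => [i|] ->; [exact: p_gt0|exact: p0_gt0]. Qed.

Lemma rho_gt0 i : 0 < rho i.
Proof. by rewrite divr_gt0 ?p_gt0// p0_gt0. Qed.

Lemma rho_lt1 i : rho i < 1.
Proof. by rewrite ltr_pdivrMr ?p0_gt0// mul1r (le_lt_trans (le_pstar i)). Qed.

Lemma carrier_pi_gt0 w : 0 < carrier_pi p w.
Proof.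
apply: prodr_gt0 => i _; rewrite mulr_gt0 ?subr_gt0 ?rho_lt1//.
by rewrite exprn_gt0// rho_gt0.
Qed.

Lemma prod_rho_inserted c :
  \prod_(i < kappa) rho i ^+ (i.+1 == inserted c) = p c / p ord0.
Proof.
case: (unliftP ord0 c) => [j|] ->.
  rewrite inserted_lift (bigD1 j)//= eqxx expr1 big1 ?mulr1// => i ij.
  by rewrite eqSS -val_eqE/= in ij *; rewrite (negPf ij) expr0.
rewrite divff ?gt_eqF ?p0_gt0// big1// => i _.
by rewrite inserted0 eqSS ltn_eqF ?expr0.
Qed.

Lemma prod_rho_letter (c : 'I_kappa.+1) :
  \prod_(i < kappa) rho i ^+ (i.+1 == c) = p c / p ord0.
Proof.
rewrite -prod_rho_inserted; apply: eq_bigr => i _; congr (_ ^+ _).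
by rewrite /inserted; case: (eqVneq c ord0) => [->|_]//; rewrite eqSS (ltn_eqF (ltn_ord i)).
Qed.

(** A color-i ball has weight p_i / p_0 in pi, and the number of balls of each
    color plus the ejected one equals the old number plus the inserted one. *)
Lemma carrier_pi_step w c :
  carrier_pi p (carrier_step w c) * p (out w c) = carrier_pi p w * p c.
Proof.
have p00 : p ord0 != 0 by rewrite gt_eqF ?p0_gt0.
have pE (e : 'I_kappa.+1) : p e = p e / p ord0 * p ord0 by rewrite divfK.
rewrite (pE (out w c)) (pE c) [LHS]mulrA [RHS]mulrA; congr (_ * _).
rewrite -prod_rho_letter -prod_rho_inserted /carrier_pi -!big_split/=.
apply: eq_bigr => i _; rewrite -!mulrA -!exprD; congr (_ * _ ^+ _).
by rewrite outE; exact: carrier_stepE.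
Qed.

Lemma sum_box_pi M : \sum_(f : {ffun 'I_kappa -> 'I_M.+1}) carrier_pi p (unbox f) =
  \prod_(i < kappa) (1 - rho i ^+ M.+1).
Proof.
transitivity (\prod_(i < kappa) \sum_(k < M.+1) (1 - rho i) * rho i ^+ k).
  rewrite bigA_distr_bigA; apply: eq_bigr => f _; apply: eq_bigr => i _.
  by rewrite ffunE.
apply: eq_bigr => i _; rewrite -mulr_sumr.
by rewrite -opprB -[in RHS]opprB subrX1 mulNr.
Qed.

(** Boxes exhaust the states, and the mass of a box is a product of truncated
    geometric sums. *)
Lemma carrier_pi_sum1 : \esum_(w in [set: state]) (carrier_pi p w)%:E = 1%E.
Proof.
have pi0 w : 0 <= carrier_pi p w by exact/ltW/carrier_pi_gt0.
apply/eqP; rewrite eq_le; apply/andP; split.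
  apply: ge_ereal_sup => _ [X [finX _] <-].
  have [M XM] := finite_sub_box finX.
  apply: (@le_trans _ _ (\esum_(w in box M) (carrier_pi p w)%:E)).
    by apply: ereal_sup_ubound; exists X.
  rewrite esum_box// lee_fin sum_box_pi; apply: prodr_ile1 => i _.
  rewrite subr_ge0 gerBl exprn_ge0 ?andbT ?(ltW (rho_gt0 i))//.
  by rewrite exprn_ile1 ?(ltW (rho_gt0 i)) ?(ltW (rho_lt1 i)).
have cvg1 : (\prod_(i < kappa) (1 - rho i ^+ M.+1))%:E @[M --> \oo] --> 1%:E.
  apply: cvg_EFin; first by apply: nearW.
  suff : \prod_(i < kappa) (1 - rho i ^+ M.+1) @[M --> \oo] --> \prod_(i < kappa) (1 - 0 : R).
    by rewrite (_ : \prod_(i < kappa) (1 - 0) = 1)// big1// => i _; rewrite subr0.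
  have prod_cvg := @cvg_big R _ *%R 1 xpredT (@mul_continuous R) _ (nbhs \oo)
    (index_enum 'I_kappa) (fun i M => 1 - rho i ^+ M.+1) (fun=> 1 - 0) _.
  apply: prod_cvg.
  move=> i _; apply: cvgB; first exact: cvg_cst.
  by rewrite (cvg_shiftS (fun M => rho i ^+ M)); apply: cvg_expr;
    rewrite ger0_norm ?rho_lt1// ltW// rho_gt0.
rewrite -(cvg_lim _ cvg1)//; apply: lime_le; first exact: cvgP cvg1.
apply: nearW => M; rewrite -sum_box_pi -esum_box//.
rewrite [leRHS](esumID (box M))// ?setTI; last by move=> w _; rewrite lee_fin.
by rewrite leeDl// esum_ge0// => w _; rewrite lee_fin.
Qed.

(** The sum of pi(w) p(c) over the pairs leading to v becomes, under the weight
    preserving bijection (w, c) |-> (carrier_step w c, out w c), the sum of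
    pi(v) p(o) over all letters o. *)
Lemma carrier_pi_stationary : stationary_distribution (carrier_matrix p) (carrier_pi p).
Proof.
have pi0 w : 0 <= carrier_pi p w by exact/ltW/carrier_pi_gt0.
split => //; first exact: carrier_pi_sum1.
move=> v; pose F (x : state * 'I_kappa.+1) : \bar R :=
  if x.1 == v then (carrier_pi p x.1 * p x.2)%:E else 0%E.
have F0 x : (0 <= F x)%E by rewrite /F; case: ifP => // _; rewrite lee_fin mulr_ge0.
have bij : set_bij ([set: state] `*`` fun=> [set: 'I_kappa.+1])
    ([set: state] `*`` fun=> [set: 'I_kappa.+1])
    (fun x => (carrier_step x.1 x.2, out x.1 x.2)).
  split=> //; first by move=> x y _ _; exact: step_out_inj.
  by move=> [u o] _; have [w [c [<- <-]]] := step_out_surj u o; exists (w, c).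
transitivity (\esum_(x in [set: state] `*`` fun=> [set: 'I_kappa.+1]) F x).
  rewrite (reindex_esum _ _ _ _ bij) -(esum_esum (J := fun=> setT)
    (a := fun w c => F (carrier_step w c, out w c)))//.
  apply: eq_esum => w _; rewrite esum_finType// /carrier_matrix mulr_sumr -sumEFin.
  rewrite big_mkcond; apply: eq_bigr => c _; rewrite /F /=.
  by rewrite carrier_pi_step.
rewrite -(esum_esum (J := fun=> setT) (a := fun w c => F (w, c)))//.
rewrite -(@esum_set1 _ _ v (fun w => (carrier_pi p w)%:E)) ?lee_fin//.
rewrite [RHS]esum_mkcond; apply: eq_esum => w _; rewrite esum_finType// /F/=.
case: (eqVneq w v) => [->|/eqP wv]; last by rewrite big1// memNset.
by rewrite mem_set//= sumEFin -mulr_sumr p_sum1 mulr1.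
Qed.

End Stationary.

(** * Irreducibility, recurrence and convergence *)

Section Convergence.
Context {R : realType} {kappa : nat}.
Local Notation state := (carrier_state kappa).
Variables (p : 'I_kappa.+1 -> R).
Hypotheses (p_ge0 : forall c, 0 <= p c) (p_sum1 : \sum_(c < kappa.+1) p c = 1)
  (p_gt0 : forall i : 'I_kappa, 0 < p (lift ord0 i)) (hp : pstar p < p ord0).
Implicit Types (w v : state) (c : 'I_kappa.+1) (i : 'I_kappa).

Local Notation onestep := (onestep p (@carrier_step kappa)).
Local Notation avoid := (avoid p (@carrier_step kappa)).

Let pi_gt0 := carrier_pi_gt0 p_ge0 p_gt0 hp.
Let pi_st := carrier_pi_stationary p_ge0 p_sum1 p_gt0 hp.

Lemma path_to_origin w : foldl (@carrier_step kappa) w (nseq (norm1 w) ord0) = origin.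
Proof.
have [n] : exists n, norm1 w = n by exists (norm1 w).
elim: n w => [|n IH] w wn; rewrite wn /=; first by apply/eqP; rewrite -norm1_eq0 wn.
by have := IH (carrier_step w ord0); rewrite norm1_step0 wn; apply.
Qed.

Lemma path_from_origin w : exists s, foldl (@carrier_step kappa) origin s = w.
Proof.
have [n] : exists n, norm1 w = n by exists (norm1 w).
elim: n w => [|n IH] w wn.
  by exists [::]; apply/esym/eqP; rewrite -norm1_eq0 wn.
have [|v [i [vw vn]]] := @ex_insert kappa w; first by rewrite -norm1_eq0 wn.
have [|s sv] := IH v; first by move: vn; rewrite wn => -[].
by exists (rcons s (lift ord0 i)); rewrite foldl_rcons sv.
Qed.

Lemma carrier_irreducible : irreducible_chain (carrier_matrix p).
Proof.
move=> x y; have [s sy] := path_from_origin y.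
exists (size (nseq (norm1 x) ord0 ++ s)); apply: nstep_gt0 => //.
  by move=> c _; exact: letter_gt0.
by rewrite foldl_cat path_to_origin.
Qed.

(** A loop at x through the origin can be lengthened by one step, because the
    letter 0 leaves the origin fixed. *)
Lemma carrier_aperiodic : aperiodic_chain (carrier_matrix p).
Proof.
move=> x g gP; have [s sx] := path_from_origin x.
have pos t : foldl (@carrier_step kappa) x t = x ->
    (0 < nstep (carrier_matrix p) (size t) x x)%E.
  by apply: nstep_gt0 => // c _; exact: letter_gt0.
have stay : carrier_step (origin : state) ord0 = origin.
  by apply/eqP; rewrite -norm1_eq0 norm1_step0 norm1_origin.
pose l := size (nseq (norm1 x) ord0 ++ s).
have h1 : (0 < nstep (carrier_matrix p) l x x)%E.
  by apply: pos; rewrite foldl_cat path_to_origin.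
have h2 : (0 < nstep (carrier_matrix p) l.+1 x x)%E.
  have -> : l.+1 = size (nseq (norm1 x) ord0 ++ ord0 :: s).
    by rewrite /l !size_cat /= addnS.
  by apply: pos; rewrite foldl_cat path_to_origin /= stay.
have g2 : (g %| l.+1)%N by exact: gP.
have g1 : (g %| l)%N.
  by have [->//|l0] := posnP l; apply: gP.
by apply/eqP; rewrite -dvdn1 -(@dvdn_addr l)// addn1.
Qed.

Lemma carrier_positive_recurrent : positive_recurrent (carrier_matrix p).
Proof. exact: (positive_recurrent_stationary p_ge0 p_sum1 pi_st). Qed.

(** Recurrence gives the claim at the origin.  It propagates along insertions
    leading from v to w <> origin: avoiding the origin from w for n steps has
    probability at most 1 / p_i times that of avoiding it from v for n + 1. *)
Lemma avoid_origin_cvg0 w : avoid origin n w @[n --> \oo] --> 0.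
Proof.
have [n] : exists n, norm1 w = n by exists (norm1 w).
elim: n w => [|n IH] w wn.
  have -> : w = origin by apply/eqP; rewrite -norm1_eq0 wn.
  exact: (avoid_cvg0 p_ge0 p_sum1 pi_st).
have w0 : w != origin by rewrite -norm1_eq0 wn.
have [v [i [vw vn]]] := ex_insert w0.
have {}IH := IH v; move: vn; rewrite wn => -[/IH vcvg].
have pi0 := p_gt0 i.
apply: (@squeeze_cvgr _ _ _ _ (fun=> 0) (fun n => (p (lift ord0 i))^-1 * avoid origin n.+1 v)).
- apply: nearW => m; rewrite avoid_ge0//= mulrC ler_pdivlMr// mulrC.
  have := @onestep_ge_step _ _ _ p carrier_step p_ge0
    (fun z => (z != origin)%:R * avoid origin m z) v (lift ord0 i).
  rewrite vw w0 mul1r; apply => z; rewrite mulr_ge0//; exact: avoid_ge0.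
- exact: cvg_cst.
- rewrite -(mulr0 (p (lift ord0 i))^-1); apply: cvgM; first exact: cvg_cst.
  by rewrite (cvg_shiftS (fun m => avoid origin m v)).
Qed.

(** P_w(the origin is not visited at times 0, ..., t). *)
Definition uncoupled t w : R := (w != origin)%:R * avoid origin t w.

Lemma uncoupled_in01 t : in01 (uncoupled t).
Proof. exact/in01_neqM/avoid_in01. Qed.

Lemma uncoupled_cvg0 (mu : state -> R) :
  (forall w, 0 <= mu w) -> \esum_(w in [set: state]) (mu w)%:E = 1%E ->
  avg mu (uncoupled t) @[t --> \oo] --> 0.
Proof.
move=> mu0 mu1; apply: avg_cvg0 => //; first exact: uncoupled_in01.
move=> w; rewrite -(mulr0 (w != origin)%:R); apply: cvgM; first exact: cvg_cst.
exact: avoid_origin_cvg0.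
Qed.

(** Both carriers read the same letters and keep their order, so they coincide
    from the first time at which the upper one is at the origin. *)
Lemma coupling t f v w : in01 f -> tail_le v w ->
  `|iter t onestep f v - iter t onestep f w| <= uncoupled t w.
Proof.
move=> f01; elim: t v w => [|t IH] v w; have [->|w0] := eqVneq w origin.
- by move=> /tail_le_eq_origin ->; rewrite subrr normr0 /uncoupled eqxx mul0r.
- move=> vw; rewrite /uncoupled w0 mulr1 /= ler_norml.
  by case/andP: (f01 v); case/andP: (f01 w); lra.
- by move=> /tail_le_eq_origin ->; rewrite subrr normr0 /uncoupled eqxx mul0r.
- move=> vw; rewrite /uncoupled w0 mul1r /= /onestep -sumrB; apply: le_trans (ler_norm_sum _ _ _) _.
  apply: ler_sum => c _; rewrite -mulrBr normrM ger0_norm// ler_wpM2l//.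
  exact/IH/tail_le_step.
Qed.

(** Average the coupling bound for the carriers started at origin and at w over
    w distributed as mu. *)
Lemma stationary_near (mu : state -> R) t f :
  stationary_distribution (carrier_matrix p) mu -> in01 f ->
  `|iter t onestep f origin - avg mu f| <= avg mu (uncoupled t).
Proof.
move=> mu_st f01; have [mu0 mu1 _] := mu_st.
rewrite -(avg_iter_onestep p_ge0 p_sum1 mu_st t f01).
have it01 : in01 (iter t onestep f) by exact: iter_onestep_in01.
have c01 := it01 origin.
have close w := coupling t f01 (tail_le_origin w).
rewrite ler_norml lerBrDr addrC -[in X in X && _](avg_cst mu0 mu1 c01).
rewrite lerBlDr -[in X in _ && X](avg_cst mu0 mu1 c01) addrC.
rewrite lerBlDr !avg_le_add//; try exact: uncoupled_in01.
- by move=> w; have := close w; rewrite ler_norml => /andP[]; lra.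
- by move=> w; have := close w; rewrite ler_norml => /andP[]; lra.
Qed.

(** Any stationary law is the limit of the laws of the carrier started at the
    origin. *)
Lemma stationary_unique (mu : state -> R) :
  stationary_distribution (carrier_matrix p) mu -> mu = carrier_pi p.
Proof.
move=> mu_st; apply/funext => y.
have lim nu : stationary_distribution (carrier_matrix p) nu ->
    iter t onestep (fun z => (z == y)%:R) origin @[t --> \oo] --> nu y.
  move=> nu_st; have [nu0 nu1 _] := nu_st.
  have <- : avg nu (fun z => (z == y)%:R) = nu y.
    rewrite -[RHS]mulr1 -(avg_point nu0 nu1); last by rewrite ler01 lexx.
    by apply: eq_avg => z; rewrite mulr1.
  apply/cvgrPdist_le => e e0.
  have /cvgrPdist_le/(_ _ e0) := uncoupled_cvg0 nu0 nu1; apply: filterS => t /=.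
  rewrite sub0r normrN distrC => h; apply: le_trans h.
  apply: le_trans (ler_norm _); apply: stationary_near => //; exact: in01_eq.
by apply: (cvg_unique _ (lim mu mu_st) (lim _ pi_st)); exact: norm_hausdorff.
Qed.

End Convergence.

(** * Events that depend on finitely many letters *)

Section Words.
Context {R : realType} {E : finType}.
Variable p : E -> R.
Implicit Types (F G : seq E -> R) (s : seq E).

(** Expectation of F over words of n independent letters, peeling off the first
    letter to match the backward operator. *)
Fixpoint word_mean n F : R :=
  if n is n'.+1 then \sum_c p c * word_mean n' (fun s => F (c :: s)) else F [::].

Lemma eq_word_mean n F G : (forall s, size s = n -> F s = G s) ->
  word_mean n F = word_mean n G.
Proof.
elim: n F G => [|n IH] F G FG /=; first exact: FG.
by apply: eq_bigr => c _; congr (_ * _); apply: IH => s sn; rewrite FG//= sn.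
Qed.

Lemma word_mean_rcons n F :
  word_mean n.+1 F = word_mean n (fun s => \sum_c p c * F (rcons s c)).
Proof.
elim: n F => [|n IH] F; first by apply: eq_bigr.
transitivity (\sum_c p c * word_mean n.+1 (fun s => F (c :: s))) => //.
by apply: eq_bigr => c _; rewrite IH.
Qed.

Lemma word_meanZr n F (a : R) : word_mean n (fun s => F s * a) = word_mean n F * a.
Proof.
elim: n F => [//|n IH] F /=; rewrite mulr_suml.
by apply: eq_bigr => c _; rewrite IH mulrA.
Qed.

Lemma word_mean_foldl (S : countType) (step : S -> E -> S) n (f : S -> R) w :
  word_mean n (fun s => f (foldl step w s)) = iter n (onestep p step) f w.
Proof. by elim: n w => //= n IH w; apply: eq_bigr => c _; rewrite -IH. Qed.

End Words.

Section Windows.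
Context {R : realType} {d : measure_display} {Omega : measurableType d}.
Context {E : finType}.
Variables (P : probability Omega R) (xi : nat -> Omega -> E) (p : E -> R) (c0 : E).
Hypothesis xi_iid : iid P xi p.
Implicit Types (B : pred (seq E)).

Definition window k n (w : Omega) := mkseq (fun i => xi (k + i) w) n.

Lemma windowS k n w : window k n.+1 w = xi k w :: window k.+1 n w.
Proof.
rewrite /window /mkseq /= addn0; congr cons.
rewrite -[1%N]/(1 + 0)%N iotaDl -map_comp; apply: eq_map => i /=.
by rewrite ?add1n addSnnS.
Qed.

Lemma window_rcons n w : window 0 n.+1 w = rcons (window 0 n w) (xi n w).
Proof. by rewrite /window mkseqS. Qed.

Let xi_meas k c : measurable (xi k @^-1` [set c]).
Proof. by case: xi_iid. Qed.

Lemma measurable_window k n B : measurable [set w | B (window k n w)].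
Proof.
elim: n k B => [|n IH] k B.
  rewrite (_ : [set _ | _] = if B [::] then setT else set0); first by case: ifP.
  by apply/seteqP; split=> w; rewrite /window /=; case: (B [::]).
rewrite (_ : [set _ | _] = \bigcup_(c in [set: E])
    (xi k @^-1` [set c] `&` [set w | B (c :: window k.+1 n w)])).
  apply: fin_bigcup_measurable; first exact: finite_finset.
  by move=> c _; apply: measurableI => //; exact: (IH _ (fun s => B (c :: s))).
apply/seteqP; split=> w /=; rewrite windowS.
  by move=> h; exists (xi k w).
by move=> [c _ [/= -> h]].
Qed.

Lemma prob_word s : P [set w | window 0 (size s) w = s] = (\prod_(c <- s) p c)%:E.
Proof.
case: xi_iid => _ xip indep.
have := indep (iota 0 (size s)) (fun x => [set nth c0 s x]) (iota_uniq _ _).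
rewrite (_ : [set w | forall x, x \in iota 0 (size s) -> [set nth c0 s x] (xi x w)] =
  [set w | window 0 (size s) w = s]).
  move=> ->; congr EFin; rewrite [RHS](big_nth c0) /index_iota subn0.
  by apply: eq_bigr => x _; rewrite xip.
apply/seteqP; split=> w /= h.
  apply: (@eq_from_nth _ c0); rewrite size_mkseq// => i si.
  by rewrite nth_mkseq//; apply: h; rewrite mem_iota.
move=> x; rewrite mem_iota /= add0n => xs.
by rewrite -[in RHS]h nth_mkseq.
Qed.

Lemma prob_split (k : nat) (A : set Omega) : measurable A ->
  (P A = \sum_c P (A `&` xi k @^-1` [set c]))%E.
Proof.
move=> mA; rewrite -esum_finType// esum_fset//; last exact: finite_finset.
rewrite -measure_fin_bigcup.
- congr (P _); apply/seteqP; split=> w; last by case=> c _ [].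
  by move=> Aw; exists (xi k w).
- exact: finite_finset.
- by move=> c c' _ _ [w /= [[_ <-] [_ <-]]].
- by move=> c _; exact: measurableI.
Qed.

(** The induction on the length of the window needs the word read before it: the
    first letter of the window is moved to the end of that word. *)
Lemma prob_word_window s n B :
  P [set w | window 0 (size s) w = s /\ B (window (size s) n w)] =
  (\prod_(c <- s) p c * word_mean p n (fun u => (B u)%:R))%:E.
Proof.
elim: n s B => [|n IH] s B.
  rewrite /= /window /=; case: (B [::]); last first.
    by rewrite mulr0 -[RHS](measure0 P); congr (P _); apply/seteqP; split=> w // [].
  rewrite mulr1 -prob_word; congr (P _).
  by apply/seteqP; split=> w //; case.
have meas : measurable [set w | window 0 (size s) w = s /\ B (window (size s) n.+1 w)].
  rewrite (_ : [set _ | _] = [set w | window 0 (size s) w == s] `&`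
    [set w | B (window (size s) n.+1 w)]); last first.
    by apply/seteqP; split=> w /= [] /eqP.
  apply: measurableI; last exact: measurable_window.
  exact: (measurable_window 0 (size s) (fun u => u == s)).
rewrite (prob_split (size s))// /= mulr_sumr -sumEFin; apply: eq_bigr => c _.
have := IH (rcons s c) (fun u => B (c :: u)).
rewrite big_rcons/= size_rcons mulrA => <-; congr (P _); apply/seteqP.
split=> w /=; rewrite (windowS (size s)) window_rcons.
  by move=> [[-> Bw] <-].
move=> [/rcons_inj[-> <-] Bw]; split => //.
Qed.

(** Transfers every event about finitely many letters to a finite sum. *)
Lemma prob_window n B :
  P [set w | B (window 0 n w)] = (word_mean p n (fun u => (B u)%:R))%:E.
Proof.
have := prob_word_window [::] n B; rewrite big_nil mul1r => <-.
by congr (P _); apply/seteqP; split=> w //= [].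
Qed.

End Windows.

(** * The carrier as a process, and its excursions *)

Section CarrierLaw.
Context {R : realType} {kappa : nat} {d : measure_display} {Omega : measurableType d}.
Local Notation state := (carrier_state kappa).
Variables (p : 'I_kappa.+1 -> R) (P : probability Omega R).
Variable xi : nat -> Omega -> 'I_kappa.+1.
Hypotheses (p_ge0 : forall c, 0 <= p c) (p_sum1 : \sum_(c < kappa.+1) p c = 1)
  (xi_iid : iid P xi p).
Variable W : nat -> Omega -> state.
Hypothesis W_def : forall x w, W x w = carrier origin (fun y => xi y w) x.

Local Notation step := (@carrier_step kappa).

Lemma carrier_window x w : W x w = foldl step origin (window xi 0 x w).
Proof.
rewrite W_def; elim: x => [//|x IH].
by rewrite window_rcons foldl_rcons -IH.
Qed.

Lemma take_window k n w : (k <= n)%N -> take k (window xi 0 n w) = window xi 0 k w.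
Proof. by move=> kn; rewrite /window /mkseq -map_take take_iota (minn_idPl kn). Qed.

Lemma carrier_law x (A : set state) :
  law P (W x) A = (iter x (onestep p step) \1_A origin)%:E.
Proof.
rewrite -word_mean_foldl -(prob_window ord0 xi_iid x (fun s => foldl step origin s \in A)).
congr (P _); apply/seteqP; split=> w /=; rewrite carrier_window.
  by move=> h; apply/mem_set.
by move=> /set_mem.
Qed.

Lemma carrier_measurable x (A : set state) : measurable (W x @^-1` A).
Proof.
rewrite (_ : _ @^-1` _ = [set w | foldl step origin (window xi 0 x w) \in A]).
  exact: (measurable_window xi_iid 0 x (fun s => foldl step origin s \in A)).
apply/seteqP; split=> w /=; rewrite carrier_window; first by move=> h; apply/mem_set.
by move=> /set_mem.
Qed.

(** The trajectory up to time n is a function of the first n letters; the last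
    letter of a word of length n + 1 is independent of them. *)
Lemma carrier_markov : markov_chain P W (carrier_matrix p).
Proof.
split; first exact: kernel_stochastic.
  by move=> n x; exact: carrier_measurable.
move=> n s.
pose follows m (u : seq 'I_kappa.+1) :=
  `[< forall k, (k <= m)%N -> foldl step origin (take k u) = s k >].
have eventE m : [set w | forall k, (k <= m)%N -> W k w = s k] =
    [set w | follows m (window xi 0 m w)].
  apply/seteqP; split=> w /=.
    by move=> h; apply/asboolP => k km; rewrite take_window// -carrier_window h.
  by move=> /asboolP h k km; rewrite carrier_window -h// take_window.
rewrite !eventE !(prob_window ord0 xi_iid) -EFinM -word_meanZr word_mean_rcons.
congr EFin; apply: eq_word_mean => u un.
have followsS c : follows n.+1 (rcons u c) = follows n u && (step (s n) c == s n.+1).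
  apply/asboolP/andP => [h|[/asboolP h /eqP sc] k].
    have hn k : (k <= n)%N -> foldl step origin (take k u) = s k.
      by move=> kn; rewrite -(h k (leqW kn)) -cats1 takel_cat// un.
    split; first exact/asboolP.
    have := h n.+1 (leqnn _); rewrite take_oversize ?size_rcons ?un// foldl_rcons.
    by rewrite -(hn n)// take_oversize ?un// => ->.
  rewrite leq_eqVlt => /predU1P[->|kn].
    rewrite take_oversize ?size_rcons ?un// foldl_rcons -sc -(h n)//.
    by rewrite take_oversize ?un.
  by rewrite -cats1 takel_cat ?un// h.
under eq_bigr do rewrite followsS.
rewrite /carrier_matrix mulr_sumr [RHS]big_mkcond/=; apply: eq_bigr => c _.
by case: (follows n u) (_ == s n.+1) => [] [] /=; rewrite ?mulr1 ?mulr0 ?mul1r ?mul0r.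
Qed.

Variable N : nat.

(** Reading the letters of s from w, the norm reaches N before the origin is
    visited.  Time 0 is tested for both. *)
Fixpoint reaches (w : state) (s : seq 'I_kappa.+1) : bool :=
  (N <= norm1 w)%N || ((w != origin) && if s is c :: s' then reaches (step w c) s' else false).

(** The probability of reaches over n independent letters, defined by
    conditioning on the first letter so that it is harmonic by construction. *)
Fixpoint reach_prob (n : nat) (w : state) : R :=
  if (N <= norm1 w)%N then 1 else if w == origin then 0 else
  if n is n'.+1 then onestep p step (reach_prob n') w else 0.

Lemma word_mean_cst n (a : R) : word_mean p n (fun=> a) = a.
Proof.
elim: n => //= n IH; rewrite -[RHS](onestep_cst step p_sum1 a origin).
by apply: eq_bigr => c _; rewrite IH.
Qed.

Lemma word_mean_reaches n w :
  word_mean p n (fun s => (reaches w s)%:R) = reach_prob n w.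
Proof.
elim: n w => [|n IH] w.
  by rewrite /=; case: ifP => //= _; rewrite andbF; case: ifP.
have [Nw|Nw] := leqP N (norm1 w).
  rewrite (@eq_word_mean _ _ _ _ _ (fun=> 1)) ?word_mean_cst/= ?Nw//.
  by move=> [|c s] _ /=; rewrite Nw.
have [w0|w0] := eqVneq w origin.
  rewrite (@eq_word_mean _ _ _ _ _ (fun=> 0)) ?word_mean_cst/=; last first.
    by move=> [|c s] _ /=; rewrite leqNgt Nw w0 eqxx.
  by rewrite leqNgt Nw w0 eqxx.
rewrite /= leqNgt Nw (negPf w0); apply: eq_bigr => c _; rewrite -IH.
by congr (_ * _); apply: eq_word_mean => s _; rewrite leqNgt Nw.
Qed.

Lemma reaches_window k n w :
  reaches (W k w) (window xi k n w) <->
  exists x, [/\ (k <= x <= k + n)%N, (N <= norm1 (W x w))%N &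
    forall j, (k <= j < x)%N -> W j w <> origin].
Proof.
elim: n k => [|n IH] k.
  rewrite /= andbF orbF addn0; split=> [h|[x [kx Nx _]]].
    by exists k; split=> //; [rewrite leqnn|move=> j; lia].
  by have -> : k = x by lia.
have WS : step (W k w) (xi k w) = W k.+1 w by rewrite !W_def.
rewrite windowS /= WS; split.
  move=> /orP[Nk|/andP[/eqP k0 /IH[x [kx Nx x0]]]].
    by exists k; split=> //; [lia|move=> j; lia].
  exists x; split=> //; first by lia.
  by move=> j kj; have [->//|jk] := eqVneq j k; apply: x0; lia.
move=> [x [kx Nx x0]]; have [xk|xk] := eqVneq x k; first by rewrite -xk Nx.
apply/orP; right; apply/andP; split; first by apply/eqP/x0; lia.
apply/IH; exists x; split=> //; first by lia.
by move=> j kj; apply: x0; lia.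
Qed.

Hypothesis N_gt0 : (0 < N)%N.

Definition reaches_by n : set Omega :=
  [set w | reaches (W 1 w) (window xi 1 n w)].

(** An excursion has height at least N exactly when, after its first step, the
    norm reaches N before the next visit to the origin.  Because heights are
    integers, a supremum at least N is attained at a value at least N. *)
Lemma excursion_heightE :
  [set w | ((N%:R)%:E <= excursion_height (R := R) (fun x => W x w))%E] =
  \bigcup_n reaches_by n.
Proof.
have leT w (x : nat) : ((x%:R)%:E <= return_time (R := R) (W ^~ w) origin)%E <->
    forall j, (0 < j < x)%N -> W j w <> origin.
  rewrite /return_time; split=> [h j /andP[j0 jx] Wj|h].
    have : ((x%:R)%:E <= (j%:R)%:E :> \bar R)%E.
      by apply: le_trans h _; apply: ereal_inf_lbound; exists j.
    by rewrite lee_fin ler_nat leqNgt jx.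
  apply: le_ereal_inf_tmp => _ [j [j0 Wj] <-]; rewrite lee_fin ler_nat leqNgt.
  by apply/negP => jx; apply: (h j) => //; rewrite j0.
apply/seteqP; split=> w.
  move=> /= Nh; apply: contrapT => none.
  have : (excursion_height (R := R) (W ^~ w) <= (N.-1%:R)%:E)%E.
    apply: ge_ereal_sup => _ [x /leT xT <-]; rewrite lee_fin ler_nat.
    rewrite -ltnS prednK// ltnNge; apply/negP => Nx; apply: none.
    have x0 : (0 < x)%N.
      by case: x Nx {xT} => //; rewrite W_def /= norm1_origin leqNgt N_gt0.
    exists x => //=; apply/reaches_window; exists x; split=> //; first by lia.
  move/(le_trans Nh); rewrite lee_fin ler_nat; lia.
move=> [n _ /reaches_window[x [_ Nx x0]]] /=.
apply: (@le_trans _ _ ((norm1 (W x w))%:R)%:E); first by rewrite lee_fin ler_nat.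
by apply: ereal_sup_ubound; exists x => //=; apply/leT.
Qed.

Lemma reaches_by_prob n :
  P (reaches_by n) = (onestep p step (reach_prob n) origin)%:E.
Proof.
pose B (s : seq 'I_kappa.+1) := if s is c :: s' then reaches (step origin c) s' else false.
rewrite (_ : reaches_by n = [set w | B (window xi 0 n.+1 w)]).
  rewrite (prob_window ord0 xi_iid) /=; congr EFin; apply: eq_bigr => c _.
  by rewrite -word_mean_reaches.
by apply/seteqP; split=> w; rewrite /reaches_by /mkset windowS W_def.
Qed.

Lemma measurable_reaches_by n : measurable (reaches_by n).
Proof.
pose B (s : seq 'I_kappa.+1) := if s is c :: s' then reaches (step origin c) s' else false.
rewrite (_ : reaches_by n = [set w | B (window xi 0 n.+1 w)]).
  exact: (measurable_window xi_iid 0 n.+1 B).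
by apply/seteqP; split=> w; rewrite /reaches_by /mkset windowS W_def.
Qed.

Lemma excursion_prob_cvg :
  (onestep p step (reach_prob n) origin)%:E @[n --> \oo] -->
  P [set w | ((N%:R)%:E <= excursion_height (R := R) (fun x => W x w))%E].
Proof.
rewrite excursion_heightE; under eq_fun do rewrite -reaches_by_prob.
apply: nondecreasing_cvg_mu; first exact: measurable_reaches_by.
  by apply: bigcupT_measurable; exact: measurable_reaches_by.
apply/nondecreasing_seqP => n; apply/subsetPset => w.
by move=> /reaches_window[x [xn Nx x0]]; apply/reaches_window; exists x; split=> //; lia.
Qed.

End CarrierLaw.

(** * Escaping from a level of the norm *)

Section Ruin.
Context {R : realType} {kappa : nat}.
Local Notation state := (carrier_state kappa).
Variables (p : 'I_kappa.+1 -> R).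
Hypotheses (p_ge0 : forall c, 0 <= p c) (p_sum1 : \sum_(c < kappa.+1) p c = 1)
  (p_gt0 : forall i : 'I_kappa, 0 < p (lift ord0 i)) (hp : pstar p < p ord0).
Implicit Types (w v : state) (c : 'I_kappa.+1) (i : 'I_kappa).

Local Notation step := (@carrier_step kappa).
Local Notation mean := (onestep p step).

Let pi_st := carrier_pi_stationary p_ge0 p_sum1 p_gt0 hp.
Let p0_gt0 := p0_gt0 p_ge0 hp.

Lemma norm1_step_ge w c : (norm1 w <= (norm1 (step w c)).+1)%N.
Proof.
case: (unliftP ord0 c) => [i|] ->; last by rewrite norm1_step0; lia.
by rewrite !norm1E tail_sum_lift_ge// leqW// leq_max leqnn.
Qed.

Lemma letter_le1 c : p c <= 1.
Proof. by rewrite -p_sum1 (bigD1 c)//= lerDl sumr_ge0. Qed.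

Lemma onestep_compl f w : mean (fun z => 1 - f z) w = 1 - mean f w.
Proof.
rewrite -[X in X - _](onestep_cst step p_sum1 1 w) /onestep -sumrB.
by apply: eq_bigr => c _; rewrite mulrBr.
Qed.

Lemma onestep_compl_ge f w c : in01 f ->
  p c * (1 - f (step w c)) <= 1 - mean f w.
Proof.
move=> f01; rewrite -onestep_compl.
apply: (@onestep_ge_step _ _ _ p step p_ge0 (fun z => 1 - f z)) => z.
by rewrite subr_ge0; case/andP: (f01 z).
Qed.

Lemma reach_prob_in01 N n : in01 (reach_prob p N n).
Proof.
elim: n => [|n IH] w /=; do 2 (case: ifP => _; first by rewrite lexx ler01);
  first by rewrite lexx ler01.
exact: onestep_in01.
Qed.

Lemma reach_prob_nondec N n w : reach_prob p N n w <= reach_prob p N n.+1 w.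
Proof.
elim: n w => [|n IH] w /=; do 2 case: ifP => // _.
  by have /andP[] := onestep_in01 step p_ge0 p_sum1 (reach_prob_in01 N 0) w.
exact: le_onestep.
Qed.

Section Flux.
Variable N : nat.
Hypothesis N_gt0 : (0 < N)%N.
Local Notation u := (reach_prob p N).

(** For w at level N, the probability that after one step the level is not
    reached again before the origin within n further steps. *)
Definition flux n w : R := (norm1 w == N)%:R * (1 - mean (u n) w).

Lemma flux_in01 n : in01 (flux n).
Proof.
move=> w; rewrite /flux.
have /andP[m0 m1] := onestep_in01 step p_ge0 p_sum1 (reach_prob_in01 N n) w.
by case: eqP => _; rewrite ?mul1r ?mul0r ?lexx ?ler01//; lra.
Qed.

(** The function reach_prob is harmonic, up to the change of horizon, except at
    the origin and at level N.  Strictly above level N it equals 1 together with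
    its one-step expectation, because the norm decreases by at most one. *)
Lemma flux_balance n w :
  mean (u n) w + flux n w = u n.+1 w + (w == origin)%:R * mean (u n) origin.
Proof.
rewrite /flux /=; have [->|w0] := eqVneq w origin.
  by rewrite norm1_origin leqn0 (gtn_eqF N_gt0) eq_sym (gtn_eqF N_gt0) !mul0r mul1r addr0 add0r.
rewrite mul0r addr0; case: (ltngtP (norm1 w) N) => [wN|wN|_].
- by rewrite mul0r addr0.
- rewrite mul0r addr0 -[RHS](onestep_cst step p_sum1 1 w); apply: eq_bigr => c _.
  suff -> : u n (step w c) = 1 by [].
  have h : (N <= norm1 (step w c))%N by have := norm1_step_ge w c; lia.
  by case: n => [|n] /=; rewrite h.
- by rewrite mul1r; lra.
Qed.

Lemma flux_avg n : avg (carrier_pi p) (u n) + avg (carrier_pi p) (flux n) =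
  avg (carrier_pi p) (u n.+1) + carrier_pi p origin * mean (u n) origin.
Proof.
have [pi0 pi1 _] := pi_st.
have m01 := onestep_in01 step p_ge0 p_sum1 (reach_prob_in01 N n).
rewrite -(avg_onestep p_ge0 p_sum1 pi_st (reach_prob_in01 N n)).
rewrite -avgD//; last exact: flux_in01.
rewrite -(avg_point pi0 pi1 origin (m01 origin)) -avgD//.
- by apply: eq_avg => w; exact: flux_balance.
- exact: reach_prob_in01.
- move=> w; case: (w == origin); rewrite ?mul1r ?mul0r ?lexx ?ler01//.
Qed.

Definition shell_mass : R := avg (carrier_pi p) (fun w => (norm1 w == N)%:R).

Lemma shell_in01 : in01 (fun w => (norm1 w == N)%:R : R).
Proof. by move=> w; case: eqP; rewrite lexx ler01. Qed.

Lemma reach_upper n : carrier_pi p origin * mean (u n) origin <= shell_mass.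
Proof.
have [pi0 pi1 _] := pi_st.
have h1 : avg (carrier_pi p) (flux n) <= shell_mass.
  apply: le_avg => //; [exact: flux_in01|exact: shell_in01|] => w.
  have /andP[m0 m1] := onestep_in01 step p_ge0 p_sum1 (reach_prob_in01 N n) w.
  by rewrite /flux ler_piMr// gerBl.
have h2 : avg (carrier_pi p) (u n) <= avg (carrier_pi p) (u n.+1).
  by apply: le_avg => //; try exact: reach_prob_in01; exact: reach_prob_nondec.
by have := flux_avg n; lra.
Qed.

(** The error e n is the increment of the stationary average of reach_prob, a
    bounded nondecreasing sequence. *)
Lemma reach_lower q : 0 <= q <= 1 ->
  (forall n w, norm1 w = N -> q <= 1 - mean (u n) w) ->
  exists e : nat -> R, (e n @[n --> \oo] --> 0) /\
    forall n, q * shell_mass - e n <= carrier_pi p origin * mean (u n) origin.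
Proof.
move=> q01 qP; have [pi0 pi1 _] := pi_st.
pose a n := avg (carrier_pi p) (u n).
exists (fun n => a n.+1 - a n); split.
  have acvg : cvgn a.
    apply: nondecreasing_is_cvgn.
      by apply/nondecreasing_seqP => n; apply: le_avg => //;
        try exact: reach_prob_in01; exact: reach_prob_nondec.
    by exists 1 => _ [n _ <-]; apply: avg_le1 => //; exact: reach_prob_in01.
  rewrite -(subrr (limn a)); apply: cvgB => //.
  by rewrite (cvg_shiftS a).
move=> n; have := flux_avg n; rewrite -/(a n) -/(a n.+1).
suff : q * shell_mass <= avg (carrier_pi p) (flux n) by lra.
have qe : in01 (fun w => (norm1 w == N)%:R * q).
  by move=> w; case: eqP => _; rewrite ?mul1r ?mul0r ?lexx ?ler01.
have -> : q * shell_mass = avg (carrier_pi p) (fun w => (norm1 w == N)%:R * q).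
  have [q0 q1] := andP q01.
  apply: EFin_inj; rewrite -avgE// EFinM /shell_mass -avgE//; last exact: shell_in01.
  rewrite -esumZl//; last first.
    by move=> w _; rewrite lee_fin mulr_ge0.
  by apply: eq_esum => w _; rewrite -EFinM mulrC mulrA.
apply: le_avg => //; first exact: flux_in01.
move=> w; rewrite /flux; case: eqP => [wN|_]; last by rewrite !mul0r.
by rewrite !mul1r qP.
Qed.

End Flux.

Section Lyapunov.
Hypothesis hkappa : (1 <= kappa)%N.

Lemma pstar_gt0 : 0 < pstar p.
Proof. exact: lt_le_trans (p_gt0 (Ordinal hkappa)) (le_pstar _ _). Qed.

Lemma expr_unbounded (x a : R) : 1 < x -> exists n : nat, a <= x ^+ n.
Proof.
move=> x1; have d0 : 0 < x - 1 by rewrite subr_gt0.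
have bern n : 1 + n%:R * (x - 1) <= x ^+ n.
  elim: n => [|n IH]; first by rewrite mul0r addr0.
  rewrite exprS -natr1; have n0 : 0 <= n%:R :> R by [].
  have : x * (1 + n%:R * (x - 1)) <= x * x ^+ n by rewrite ler_pM2l//; lra.
  have : 0 <= n%:R * (x - 1) * (x - 1) by rewrite !mulr_ge0// ltW.
  lra.
exists (Num.truncn (`|a| / (x - 1))).+1; apply: le_trans (bern _).
have : `|a| / (x - 1) < (Num.truncn (`|a| / (x - 1))).+1%:R by exact: truncnS_gt.
rewrite ltr_pdivrMr// => h; have := ler_norm a; lra.
Qed.

Variable theta : R.
Hypotheses (theta_gt1 : 1 < theta) (theta_small : theta * pstar p < p ord0).

Let gap : R := (theta - 1) * (p ord0 / theta - pstar p) / 2.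
Let L : R := 1 + theta / gap.
(** The weights L ^+ a grow with the color: inserting color i may raise a lower
    tail sum to the level of tail_sum i, and the drift of the term of index i has
    to pay for all the terms of lower index. *)
Definition lyapunov w : R := \sum_(a < kappa) L ^+ a * theta ^+ tail_sum a w.
Let b : R := \sum_(a < kappa) L ^+ a.

Let theta_gt0 : 0 < theta. Proof. exact: lt_trans theta_gt1. Qed.

Let gap_gt0 : 0 < gap.
Proof.
rewrite /gap divr_gt0// mulr_gt0 ?subr_gt0//.
by rewrite ltr_pdivlMr// mulrC.
Qed.

Let L_gt1 : 1 < L.
Proof. by rewrite /L ltrDl divr_gt0. Qed.

(** The choice of L: the terms of lower index cost at most one gap. *)
Let L_geom i : theta * \sum_(a < i) L ^+ a <= gap * L ^+ i.
Proof.
have tE : theta = gap * (L - 1).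
  by rewrite /L addrAC subrr add0r mulrC divfK// gt_eqF.
by rewrite {1}tE -mulrA -subrX1 ler_pM2l// gerBl.
Qed.

(** The letters 0 and a alone multiply theta ^+ tail_sum a by less than 1 on
    average, since theta * p_a < p_0.  The letters i > a bring in the terms of
    higher index, and the constant 1 covers the case of an empty tail. *)
Let mean_coord (a : 'I_kappa) w :
  mean (fun z => theta ^+ tail_sum a z) w <=
  (1 - gap *+ 2) * theta ^+ tail_sum a w + 1 +
  theta * \sum_(i < kappa | (a < i)%N) theta ^+ tail_sum i w.
Proof.
set T := theta ^+ tail_sum a w.
have T0 : 0 < T by rewrite exprn_gt0.
have zero : p ord0 * theta ^+ tail_sum a (step w ord0) <= p ord0 * (T / theta) + 1.
  rewrite tail_sum_step0; have [T1|T1] := posnP (tail_sum a w).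
    rewrite T1 expr0 mulr1; apply: le_trans (letter_le1 _) _.
    by rewrite lerDr mulr_ge0 ?(ltW p0_gt0)// divr_ge0// ltW.
  by rewrite /T -{2}(prednK T1) exprS mulrAC divff ?mul1r ?lerDl// gt_eqF.
have ins i : p (lift ord0 i) * theta ^+ tail_sum a (step w (lift ord0 i)) <=
    p (lift ord0 i) * T + (i == a)%:R * (p (lift ord0 a) * (theta - 1) * T) +
    (if (a < i)%N then theta * theta ^+ tail_sum i w else 0).
  have pi0 := p_gt0 i; have [ai|ia|/val_inj <-] := ltngtP a i.
  - rewrite -val_eqE/= (gtn_eqF ai) mul0r addr0 tail_sum_lift_ge 1?ltnW//.
    have m : theta ^+ maxn (tail_sum a w) (tail_sum i w).+1 <= T + theta * theta ^+ tail_sum i w.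
      rewrite -exprS /maxn; case: ifP => _; first by rewrite lerDr ltW.
      by rewrite lerDl ltW// exprn_gt0.
    have t0 : 0 < theta * theta ^+ tail_sum i w by rewrite -exprS exprn_gt0.
    apply: le_trans (ler_wpM2l (ltW pi0) m) _; rewrite mulrDr lerD2l.
    by rewrite ler_piMl ?letter_le1// ltW.
  - by rewrite -val_eqE/= (ltn_eqF ia) mul0r !addr0 tail_sum_lift_lt.
  - rewrite eqxx mul1r addr0 tail_sum_lift_ge// (maxn_idPr (leqnSn _)) exprS -/T.
    by rewrite le_eqVlt; apply/orP; left; apply/eqP; ring.
rewrite /onestep big_ord_recl; apply: le_trans (lerD zero (ler_sum _ (fun i _ => ins i))) _.
rewrite !big_split/= -mulr_suml -mulr_suml.
have -> : \sum_(i < kappa) (i == a)%:R = 1 :> R.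
  by rewrite (bigD1 a)//= eqxx big1 ?addr0// => i /negPf ->.
rewrite -big_mkcond/= -mulr_sumr mul1r.
have -> : \sum_(i < kappa) p (lift ord0 i) = 1 - p ord0.
  by rewrite -p_sum1 big_ord_recl addrAC subrr add0r.
rewrite addrA lerD2r.
have pa := le_pstar p a.
have gE : gap *+ 2 = (theta - 1) * (p ord0 / theta - pstar p).
  by rewrite /gap -[_ *+ 2]mulr_natr divfK.
have tt : p ord0 * (T / theta) = p ord0 / theta * T by rewrite mulrA mulrAC.
have pt : p ord0 = p ord0 / theta * theta by rewrite divfK// gt_eqF.
rewrite gE tt; set y := p ord0 / theta in pt *; rewrite {1}pt.
have : (theta - 1) * T * p (lift ord0 a) <= (theta - 1) * T * pstar p.
  by rewrite ler_wpM2l// mulr_ge0 ?(ltW T0)// subr_ge0 ltW.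
by nra.
Qed.

Lemma lyapunov_drift w : mean lyapunov w <= (1 - gap) * lyapunov w + b.
Proof.
have -> : mean lyapunov w =
    \sum_(a < kappa) L ^+ a * mean (fun z => theta ^+ tail_sum a z) w.
  rewrite /onestep /lyapunov; under eq_bigr do rewrite mulr_sumr.
  rewrite exchange_big/=; apply: eq_bigr => a _; rewrite mulr_sumr.
  by apply: eq_bigr => c _; rewrite mulrCA.
have L0 a : 0 <= L ^+ a by rewrite exprn_ge0// ltW// (lt_trans _ L_gt1).
have coord (a : 'I_kappa) := ler_wpM2l (L0 a) (mean_coord a w).
apply: le_trans (ler_sum _ (fun a _ => coord a)) _.
under eq_bigr do rewrite !mulrDr mulr1 mulrCA.
rewrite !big_split/= -mulr_sumr -/(lyapunov w) -/b.
have cross : \sum_(a < kappa) L ^+ a * (theta * \sum_(i < kappa | (a < i)%N) theta ^+ tail_sum i w)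
    <= gap * lyapunov w.
  under eq_bigr do rewrite big_mkcond/= mulr_sumr mulr_sumr.
  rewrite exchange_big/= /lyapunov mulr_sumr; apply: ler_sum => i _.
  apply: (@le_trans _ _ (theta * (\sum_(a < i) L ^+ a) * theta ^+ tail_sum i w)).
    rewrite -mulrA mulr_suml mulr_sumr.
    rewrite (big_ord_widen _ (fun a => theta * (L ^+ a * theta ^+ tail_sum i w))
      (ltnW (ltn_ord i))).
    rewrite [leRHS]big_mkcond/=; apply: ler_sum => a _.
    by case: ifP => _; rewrite ?mulr0// mulrCA.
  by rewrite [leRHS]mulrA ler_wpM2r ?exprn_ge0 ?(ltW theta_gt0).
by move: cross; rewrite mulr2n; set X := lyapunov w; nra.
Qed.

Lemma lyapunov_ge w : theta ^+ norm1 w <= lyapunov w.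
Proof.
rewrite /lyapunov (bigD1 (Ordinal hkappa))//= expr0 mul1r norm1E lerDl.
apply: sumr_ge0 => a _; rewrite mulr_ge0// exprn_ge0 ?(ltW theta_gt0)//.
by rewrite ltW// (lt_trans _ L_gt1).
Qed.

Lemma lyapunov_le w : lyapunov w <= b * theta ^+ norm1 w.
Proof.
rewrite /b mulr_suml; apply: ler_sum => a _; rewrite ler_wpM2l//.
  by rewrite exprn_ge0// ltW// (lt_trans _ L_gt1).
by rewrite ler_eXn2l// tail_sum_le_norm1.
Qed.

Lemma lyapunov_superharmonic :
  exists r0 : nat, forall w, (r0 <= norm1 w)%N -> mean lyapunov w <= lyapunov w.
Proof.
have [r0 hr0] := expr_unbounded (b / gap) theta_gt1.
exists r0 => w wr; apply: le_trans (lyapunov_drift w) _.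
have : b <= gap * lyapunov w.
  rewrite mulrC -ler_pdivrMr//; apply: le_trans (lyapunov_ge w).
  by apply: le_trans hr0 _; rewrite ler_eXn2l.
lra.
Qed.

(** As many letters 0 as there are balls lead down to the origin. *)
Lemma reach_prob_zeros N n w : (norm1 w < N)%N ->
  reach_prob p N n w <= 1 - p ord0 ^+ norm1 w.
Proof.
move kE : (norm1 w) => k; elim: k n w kE => [|k IH] n w wk kN.
  have w0 : w == origin by rewrite -norm1_eq0 wk.
  by case: n => [|n]; rewrite /= wk leqNgt kN w0 expr0 subrr.
have w0 : w != origin by rewrite -norm1_eq0 wk.
have p01 : p ord0 ^+ k.+1 <= 1 by rewrite exprn_ile1 ?letter_le1// ltW.
case: n => [|n]; rewrite /= wk leqNgt kN (negPf w0)/=; first by rewrite subr_ge0.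
have := onestep_compl_ge w ord0 (reach_prob_in01 N n).
have := IH n (step w ord0); rewrite norm1_step0 wk => /(_ erefl (ltnW kN)) h.
have : p ord0 * p ord0 ^+ k <= p ord0 * (1 - reach_prob p N n (step w ord0)).
  by rewrite ler_pM2l//; lra.
by rewrite -exprS; lra.
Qed.

(** Off the finite set of states of norm at most r0 the Lyapunov function is
    superharmonic, so from norm N - m it reaches theta ^+ N before that set with
    probability at most 1 / 2; from the finite set, zeros lead to the origin with
    probability at least eta.  The first m + 1 letters 0 bring the norm from N
    down to the required depth, or to 0. *)
Lemma escape : exists q : R, 0 < q <= 1 /\ forall N, (0 < N)%N ->
  forall n w, norm1 w = N -> q <= 1 - mean (reach_prob p N n) w.
Proof.
have [r0 sup] := lyapunov_superharmonic.
pose eta := p ord0 ^+ r0.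
have p01 := letter_le1 ord0.
have eta0 : 0 < eta by rewrite exprn_gt0.
have eta1 : eta <= 1 by rewrite exprn_ile1// ltW.
(* From m levels below N, lyapunov is at most half of theta ^+ N. *)
have [m hm] := expr_unbounded (b * 2) theta_gt1.
have bound N n w : reach_prob p N n w <= 1 - eta + eta * (lyapunov w / theta ^+ N).
  have tN : 0 < theta ^+ N by rewrite exprn_gt0.
  have f0 w' : 0 < lyapunov w' by apply: lt_le_trans (lyapunov_ge w'); rewrite exprn_gt0.
  have large w' : (N <= norm1 w')%N -> 1 <= 1 - eta + eta * (lyapunov w' / theta ^+ N).
    move=> Nw; have : 1 <= lyapunov w' / theta ^+ N.
      rewrite ler_pdivlMr// mul1r; apply: le_trans (lyapunov_ge _).
      by rewrite ler_eXn2l.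
    by rewrite -(ler_pM2l eta0) mulr1; lra.
  have fN0 w' : 0 <= eta * (lyapunov w' / theta ^+ N).
    by rewrite mulr_ge0 ?(ltW eta0)// divr_ge0// ltW.
  (* The right-hand side is at least 1 from level N on.  It dominates the bound by
     zeros on the small states and is superharmonic on the remaining ones. *)
  elim: n w => [|n IH] w; have [Nw|wN] := leqP N (norm1 w).
  - by apply: le_trans (large _ Nw); case/andP: (reach_prob_in01 N 0 w).
  - by rewrite /= leqNgt wN /=; case: ifP => _; have := fN0 w; lra.
  - by apply: le_trans (large _ Nw); case/andP: (reach_prob_in01 N n.+1 w).
  have [wr|rw] := leqP (norm1 w) r0.
    apply: le_trans (reach_prob_zeros n.+1 wN) _.
    have : eta <= p ord0 ^+ norm1 w by rewrite ler_wiXn2l// ltW.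
    by have := fN0 w; lra.
  have w0 : w != origin by rewrite -norm1_eq0 -lt0n (leq_ltn_trans _ rw).
  rewrite /= leqNgt wN (negPf w0)/=.
  apply: le_trans (le_onestep step p_ge0 IH w) _.
  have -> : mean (fun w => 1 - eta + eta * (lyapunov w / theta ^+ N)) w =
      1 - eta + eta * (mean lyapunov w / theta ^+ N).
    rewrite -[X in _ = X + _](onestep_cst step p_sum1 (1 - eta) w) /onestep.
    rewrite mulr_suml mulr_sumr -big_split/=; apply: eq_bigr => c _.
    by rewrite mulrDr; congr (_ + _); ring.
  by rewrite lerD2l ler_pM2l// ler_pM2r ?invr_gt0// sup// ltnW.
have down N n k w : (norm1 w < N)%N -> (norm1 w + m <= N + k)%N ->
    p ord0 ^+ k * (eta / 2) <= 1 - reach_prob p N n w.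
  elim: k n w => [|k IH] n w wN wm.
    rewrite expr0 mul1r; have := bound N n w.
    suff : lyapunov w / theta ^+ N <= 1 / 2.
      by rewrite -(ler_pM2l eta0); lra.
    rewrite ler_pdivrMr ?exprn_gt0//; apply: le_trans (lyapunov_le w) _.
    have : b * 2 * theta ^+ norm1 w <= theta ^+ N.
      apply: le_trans (ler_wpM2r _ hm) _; first by rewrite exprn_ge0// ltW.
      by rewrite -exprD ler_eXn2l//; lia.
    lra.
  have k1 : p ord0 ^+ k.+1 <= 1 by rewrite exprn_ile1// ltW.
  have ke1 : p ord0 ^+ k.+1 * (eta / 2) <= 1.
    rewrite -[leRHS]mulr1 ler_pM//; [by rewrite exprn_ge0// ltW|lra|lra].
  have [w0|w0] := eqVneq w origin.
    by case: n => [|n]; rewrite /= leqNgt wN w0 eqxx subr0.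
  case: n => [|n]; rewrite /= leqNgt wN (negPf w0)/=; first by rewrite subr0.
  apply: le_trans (onestep_compl_ge w ord0 (reach_prob_in01 N n)).
  rewrite exprS -mulrA (ler_pM2l p0_gt0).
  have w1 : (0 < norm1 w)%N by rewrite lt0n norm1_eq0.
  have sN : ((norm1 w).-1 < N)%N by rewrite (leq_ltn_trans (leq_pred _)).
  have sm : ((norm1 w).-1 + m <= N + k)%N by move: wm; rewrite -(prednK w1) addSn addnS.
  have := IH n (step w ord0); rewrite norm1_step0.
  by move=> /(_ sN sm).
(* One letter 0 to leave level N, then at most m more to be m below it. *)
exists (p ord0 ^+ m.+1 * (eta / 2)); split.
  have e2 : 0 < eta / 2 by rewrite divr_gt0.
  rewrite mulr_gt0 ?exprn_gt0//= -[leRHS]mulr1 ler_pM//; try lra.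
    by rewrite exprn_ge0// ltW.
  by rewrite exprn_ile1// ltW.
move=> N N0 n w wN.
apply: le_trans (onestep_compl_ge w ord0 (reach_prob_in01 N n)).
rewrite exprS -mulrA (ler_pM2l p0_gt0).
have sN : (N.-1 < N)%N by rewrite prednK.
have sm : (N.-1 + m <= N + m)%N by rewrite leq_add2r leq_pred.
by have := down N n m (step w ord0); rewrite norm1_step0 wN => /(_ sN sm).
Qed.

End Lyapunov.
End Ruin.

(** * The mass of a level of the norm *)

Section Coefficients.
Context {R : realType}.

Definition geom_poly N (x : R) : {poly R} := \poly_(k < N.+1) x ^+ k.

Lemma coef_geom_poly N x j : (j <= N)%N -> (geom_poly N x)`_j = x ^+ j.
Proof. by move=> jN; rewrite coef_poly ltnS jN. Qed.

Lemma sum_bin_diag r j : (\sum_(i < j.+1) 'C(i + r, r) = 'C(j + r.+1, r.+1))%N.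
Proof.
elim: j => [|j IH]; first by rewrite big_ord_recr big_ord0 /= !add0n !binn.
by rewrite big_ord_recr /= IH [in RHS]addSn binS addSnnS.
Qed.

(** The number of ways to write j as an ordered sum of r + 1 naturals; truncation
    at degree N is invisible in degrees j <= N. *)
Lemma coef_geom_poly_exp N x r j : (j <= N)%N ->
  (geom_poly N x ^+ r.+1)`_j = 'C(j + r, r)%:R * x ^+ j.
Proof.
elim: r j => [|r IH] j jN; first by rewrite expr1 addn0 bin0 mul1r coef_geom_poly.
rewrite exprS coefMr -sum_bin_diag natr_sum mulr_suml; apply: eq_bigr => i _.
have ij : (i <= j)%N by rewrite -ltnS.
rewrite coef_geom_poly ?(leq_trans (leq_subr _ _))// IH ?(leq_trans ij)//.
by rewrite mulrCA -exprD subnK.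
Qed.

Lemma horner_geom_poly_le N x y : 0 <= x * y -> x * y < 1 ->
  (geom_poly N x).[y] <= (1 - x * y)^-1.
Proof.
move=> xy0 xy1; rewrite horner_poly -[leRHS]mul1r ler_pdivlMr ?subr_gt0// mulrC.
under eq_bigr do rewrite -exprMn.
by rewrite -opprB mulNr -subrX1 opprB gerBl exprn_ge0.
Qed.

Lemma coef_prod_ge0 (I : finType) (A : pred I) (F : I -> {poly R}) :
  (forall i k, 0 <= (F i)`_k) -> forall k, 0 <= (\prod_(i | A i) F i)`_k.
Proof.
move=> F0; elim/big_ind: _ => // [k|f g f0 g0 k].
  by rewrite coef1; case: eqP.
by rewrite coefM sumr_ge0// => i _; rewrite mulr_ge0.
Qed.

Lemma sum_coef_le_horner (f : {poly R}) n x : 0 <= x -> (forall k, 0 <= f`_k) ->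
  \sum_(k < n) f`_k * x ^+ k <= f.[x].
Proof.
move=> x0 f0; rewrite (@horner_coef_wide _ (maxn n (size f))) ?leq_maxr//.
rewrite (big_ord_widen _ (fun k => f`_k * x ^+ k) (leq_maxl n (size f))).
rewrite [leRHS](bigID (fun k : 'I__ => (k < n)%N))/= lerDl sumr_ge0// => k _.
by rewrite mulr_ge0// exprn_ge0.
Qed.

End Coefficients.

Section ShellMass.
Context {R : realType} {kappa : nat}.
Local Notation state := (carrier_state kappa).
Variables (p : 'I_kappa.+1 -> R).
Hypotheses (p_ge0 : forall c, 0 <= p c) (p_sum1 : \sum_(c < kappa.+1) p c = 1)
  (p_gt0 : forall i : 'I_kappa, 0 < p (lift ord0 i)) (hp : pstar p < p ord0)
  (hkappa : (1 <= kappa)%N).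
Implicit Types (i : 'I_kappa).
Local Notation rho i := (p (lift ord0 i) / p ord0).

Variable N : nat.

(** Expanding the product of geometric polynomials enumerates the states of the
    box, and the degree of a monomial is the norm of the state. *)
Lemma shell_mass_coef : shell_mass p N =
  carrier_pi p origin * (\prod_(i < kappa) geom_poly N (rho i))`_N.
Proof.
have pi_st := carrier_pi_stationary p_ge0 p_sum1 p_gt0 hp.
have [pi0 pi1 _] := pi_st.
apply: EFin_inj; rewrite /shell_mass -avgE//; last exact: shell_in01.
transitivity (\esum_(w in box N) (carrier_pi p w * (norm1 w == N)%:R)%:E).
  rewrite [RHS]esum_mkcond; apply: eq_esum => w _.
  case: ifPn => // wN; case: eqP => [wE|_]; last by rewrite mulr0.
  case/negP: wN; apply/mem_set => i.
  by rewrite -wE /norm1 (bigD1 i)//= leq_addr.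
rewrite esum_box; last by move=> w; rewrite mulr_ge0.
congr EFin; under [in RHS]eq_bigr do rewrite /geom_poly poly_def.
rewrite bigA_distr_bigA coef_sum mulr_sumr; apply: eq_bigr => f _.
rewrite scaler_prod -expr_sum coefZ coefXn.
have -> : (N == \sum_(i < kappa) f i)%N = (norm1 (unbox f) == N).
  by rewrite eq_sym; congr (_ == _); apply: eq_bigr => i _; rewrite ffunE.
rewrite mulrA; congr (_ * _); rewrite /carrier_pi -big_split/=.
by apply: eq_bigr => i _; rewrite !ffunE expr0 mulr1.
Qed.

Lemma pstar_attained : (0 < mult_pstar p)%N.
Proof.
rewrite /mult_pstar; apply/card_gt0P.
have [i _ imax] := @arg_maxP _ _ _ (Ordinal hkappa) xpredT (fun i => p (lift ord0 i)) isT.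
exists i; rewrite inE eq_le le_pstar /= /pstar.
elim/big_ind: _ => [|x y xi yi|j _]; first exact: p_ge0.
- by rewrite ge_max xi yi.
- exact: imax.
Qed.

Lemma psecond_lt : psecond p < pstar p.
Proof.
have p_pos : 0 < pstar p by exact: pstar_gt0.
by rewrite /psecond; elim/big_ind: _ => // x y xi yi; rewrite gt_max xi yi.
Qed.

Lemma le_psecond i : p (lift ord0 i) < pstar p -> p (lift ord0 i) <= psecond p.
Proof. by move=> h; rewrite /psecond (bigD1 i)//= le_max lexx. Qed.

Local Notation top := [pred i | p (lift ord0 i) == pstar p].
Local Notation rs := (pstar p / p ord0).
Local Notation others := (\prod_(i < kappa | ~~ top i) geom_poly N (rho i)).

Let r1 := (mult_pstar p).-1.
Let r1E : mult_pstar p = r1.+1. Proof. by rewrite prednK// pstar_attained. Qed.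

(** Separating the factors whose ratio is maximal. *)
Lemma prod_geom_coef : (\prod_(i < kappa) geom_poly N (rho i))`_N =
  \sum_(j < N.+1) 'C(j + r1, r1)%:R * rs ^+ j * others`_(N - j).
Proof.
rewrite (bigID top)/=.
rewrite (eq_bigr (fun=> geom_poly N rs)); last by move=> i /eqP ->.
rewrite prodr_const -/(mult_pstar p) r1E coefM; apply: eq_bigr => j _.
by rewrite coef_geom_poly_exp// -ltnS.
Qed.

Let rho0 i : 0 < rho i. Proof. exact: (rho_gt0 p_ge0 p_gt0 hp). Qed.

Let others_ge0 k : 0 <= others`_k.
Proof.
apply: coef_prod_ge0 => i j; rewrite coef_poly; case: ifP => // _.
by rewrite exprn_ge0// ltW.
Qed.

Let rs_gt0 : 0 < rs.
Proof. by rewrite divr_gt0 ?pstar_gt0// (p0_gt0 p_ge0 hp). Qed.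

(** Keep only the states whose balls all have a color of maximal probability. *)
Lemma prod_geom_ge : 'C(N + r1, r1)%:R * rs ^+ N <=
  (\prod_(i < kappa) geom_poly N (rho i))`_N.
Proof.
rewrite prod_geom_coef big_ord_recr/= subnn.
have -> : others`_0 = 1.
  rewrite -horner_coef0 horner_prod big1// => i _.
  by rewrite horner_coef0 coef_geom_poly.
rewrite mulr1 lerDr sumr_ge0// => j _.
by rewrite !mulr_ge0// exprn_ge0// ltW.
Qed.

(** The binomial coefficients are largest at j = N; once they are taken out, the
    remaining sum is at most the product of the other geometric series at
    X = (p^* / p_0)^-1, whose ratios p_i / p^* are at most p^(2) / p^*. *)
Lemma prod_geom_le : (\prod_(i < kappa) geom_poly N (rho i))`_N <=
  ruin_const p * 'C(N + r1, r1)%:R * rs ^+ N.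
Proof.
have gap0 : 0 < pstar p - psecond p by rewrite subr_gt0 psecond_lt.
have p_pos : 0 < pstar p by exact: pstar_gt0.
have p00 := p0_gt0 p_ge0 hp.
have others_le : others.[rs^-1] <= ruin_const p.
  have -> : ruin_const p = \prod_(i < kappa | ~~ top i) (pstar p / (pstar p - psecond p)).
    rewrite prodr_const /ruin_const.
    have -> : #|[pred i | ~~ top i]| = (kappa - mult_pstar p)%N.
      have : (mult_pstar p + #|[pred i | ~~ top i]| = kappa)%N.
        exact: etrans (cardC top) (card_ord _).
      lia.
    by case: eqP => // ->; rewrite subnn expr0.
  rewrite horner_prod; apply: ler_prod => i itop.
  have pi0 := p_gt0 i; have plt : p (lift ord0 i) < pstar p.
    by rewrite lt_neqAle itop le_pstar.
  have yE : rho i * rs^-1 = p (lift ord0 i) / pstar p.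
    by rewrite invf_div mulrA divfK// gt_eqF.
  have y0 : 0 <= p (lift ord0 i) / pstar p by rewrite divr_ge0// ltW.
  apply/andP; split.
    rewrite horner_poly sumr_ge0// => k _.
    by rewrite mulr_ge0// exprn_ge0// ?invr_ge0 ltW.
  apply: le_trans (horner_geom_poly_le _ _ _) _; rewrite yE//.
    by rewrite ltr_pdivrMr// mul1r.
  have -> : 1 - p (lift ord0 i) / pstar p = (pstar p - p (lift ord0 i)) / pstar p.
    by rewrite mulrBl divff// gt_eqF.
  rewrite invf_div ler_pM2l// lef_pV2 ?posrE ?subr_gt0 ?psecond_lt//.
  by have := le_psecond plt; lra.
rewrite prod_geom_coef.
apply: (@le_trans _ _ (\sum_(j < N.+1)
    'C(N + r1, r1)%:R * rs ^+ N * (others`_(N - j) * rs^-1 ^+ (N - j)))).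
  apply: ler_sum => j _; have jN : (j <= N)%N by rewrite -ltnS.
  have -> : rs ^+ N = rs ^+ j * rs ^+ (N - j) by rewrite -exprD subnKC.
  have rk : rs ^+ (N - j) * rs^-1 ^+ (N - j) = 1.
    by rewrite -exprMn divff ?expr1n// gt_eqF.
  have -> : 'C(N + r1, r1)%:R * (rs ^+ j * rs ^+ (N - j)) *
      (others`_(N - j) * rs^-1 ^+ (N - j)) =
      'C(N + r1, r1)%:R * rs ^+ j * others`_(N - j) * (rs ^+ (N - j) * rs^-1 ^+ (N - j)).
    by ring.
  rewrite rk mulr1 !ler_wpM2r ?exprn_ge0 ?(ltW rs_gt0)//.
  by rewrite ler_nat leq_bin2l// leq_add2r.
rewrite -mulr_sumr -[leRHS]mulrA [leRHS]mulrC ler_wpM2l//.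
  by rewrite mulr_ge0// exprn_ge0// ltW.
apply: le_trans others_le.
rewrite (reindex_inj rev_ord_inj)/=.
rewrite (eq_bigr (fun j : 'I_N.+1 => others`_j * rs^-1 ^+ j)).
  by apply: sum_coef_le_horner => //; rewrite invr_ge0 ltW.
move=> j _; have jN : (j <= N)%N by rewrite -ltnS.
by rewrite subSS subKn.
Qed.

End ShellMass.

(** * The theorem *)

Lemma indic_in01 (R : realType) (S : countType) (A : set S) : in01 (\1_A : S -> R).
Proof. by move=> x; rewrite indicE; case: (_ \in _); rewrite lexx ler01. Qed.

Theorem theorem2p3 (R : realType) (kappa : nat) (hkappa : (1 <= kappa)%N)
    (p : 'I_kappa.+1 -> R)
    (p_ge0 : forall c, 0 <= p c)
    (p_sum1 : \sum_(c < kappa.+1) p c = 1)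
    (p_gt0 : forall i : 'I_kappa, 0 < p (lift ord0 i))
    (hp : pstar p < p ord0)
    (d : measure_display) (Omega : measurableType d) (P : probability Omega R)
    (xi : nat -> Omega -> 'I_kappa.+1)
    (xi_iid : iid P xi p)
    (W : nat -> Omega -> carrier_state kappa)
    (W_def : forall x w, W x w = carrier origin (fun y => xi y w) x) :
  ([/\ markov_chain P W (carrier_matrix p),
       irreducible_chain (carrier_matrix p),
       aperiodic_chain (carrier_matrix p) &
       positive_recurrent (carrier_matrix p)] /\
   [/\ stationary_distribution (carrier_matrix p) (carrier_pi p),
       forall mu, stationary_distribution (carrier_matrix p) mu ->
         mu = carrier_pi p &
       tv_dist (law P (W x)) (mass (carrier_pi p)) @[x --> \oo] --> 0%E]) /\
  (exists delta : R, 0 < delta /\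
     forall N : nat, (1 <= N)%N ->
       ((delta * 'C(N + mult_pstar p - 1, mult_pstar p - 1)%:R
           * (pstar p / p ord0) ^+ N)%:E
        <= P [set w | ((N%:R)%:E <= excursion_height (R := R) (fun x => W x w))%E])%E /\
       (P [set w | ((N%:R)%:E <= excursion_height (R := R) (fun x => W x w))%E]
        <= (ruin_const p * 'C(N + mult_pstar p - 1, mult_pstar p - 1)%:R
              * (pstar p / p ord0) ^+ N)%:E)%E).
Proof.
have pi_st := carrier_pi_stationary p_ge0 p_sum1 p_gt0 hp.
have [pi0 pi1 _] := pi_st.
split; first split.
- split; first exact: carrier_markov xi_iid _ W_def.
  + exact: carrier_irreducible.
  + exact: carrier_aperiodic.
  + exact: carrier_positive_recurrent.
- split=> //; first exact: stationary_unique.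
  have tv_le x : (tv_dist (law P (W x)) (mass (carrier_pi p)) <=
      (avg (carrier_pi p) (uncoupled p x))%:E)%E.
    apply: ge_ereal_sup => _ [A _ <-].
    rewrite (carrier_law xi_iid W_def) /mass -(avg_indic pi0 pi1) -EFinB lee_fin.
    by apply: stationary_near => //; exact: indic_in01.
  have tv_ge x : (0 <= tv_dist (law P (W x)) (mass (carrier_pi p)))%E.
    apply: le_trans (ereal_sup_ubound _); last by exists set0.
    exact: abse_ge0.
  apply: (@squeeze_cvge _ _ _ _ (fun=> 0%E) _ (fun x => (avg (carrier_pi p) (uncoupled p x))%:E)).
  + by apply: nearW => x; rewrite tv_ge tv_le.
  + exact: cvg_cst.
  + by apply: cvg_EFin; [exact: nearW|exact: uncoupled_cvg0].
- have p00 := p0_gt0 p_ge0 hp; have ps0 := pstar_gt0 p_gt0 hkappa.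
  (* theta is the midpoint of 1 and p_0 / p^*. *)
  pose theta := (p ord0 + pstar p) / (2 * pstar p).
  have theta1 : 1 < theta.
    by rewrite /theta ltr_pdivlMr ?mulr_gt0// mul1r; move: hp; lra.
  have theta2 : theta * pstar p < p ord0.
    have -> : theta * pstar p = (p ord0 + pstar p) / 2.
      by rewrite /theta; field; rewrite gt_eqF.
    by move: hp; lra.
  have [q [q01 qP]] := escape p_ge0 p_sum1 p_gt0 hp hkappa theta1 theta2.
  have [q0 q1] := andP q01.
  exists q; split=> // N N0.
  pose r1 := (mult_pstar p).-1.
  have r0 := pstar_attained p_ge0 hkappa.
  have -> : (N + mult_pstar p - 1 = N + r1)%N by rewrite /r1; lia.
  have -> : (mult_pstar p - 1 = r1)%N by rewrite /r1; lia.
  have piO := carrier_pi_gt0 p_ge0 p_gt0 hp origin.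
  have shE := shell_mass_coef p_ge0 p_sum1 p_gt0 hp N.
  have hcvg := excursion_prob_cvg p_sum1 xi_iid W_def N0.
  rewrite -(cvg_lim _ hcvg)//; split; last first.
    apply: lime_le; first exact: (cvgP _ hcvg).
    apply: nearW => n; rewrite lee_fin -(ler_pM2l piO).
    apply: le_trans (reach_upper p_ge0 p_sum1 p_gt0 hp N0 n) _.
    by rewrite shE ler_pM2l//; exact: prod_geom_le.
  have q01' : 0 <= q <= 1 by rewrite ltW.
  have [e [e0 lower]] := reach_lower p_ge0 p_sum1 p_gt0 hp N0 q01' (qP N N0).
  have lcvg : (((q * shell_mass p N - e n) / carrier_pi p origin)%:E : \bar R) @[n --> \oo] -->
      (q * shell_mass p N / carrier_pi p origin)%:E.
    apply: cvg_EFin; first exact: nearW.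
    apply: cvgM; last exact: cvg_cst.
    by rewrite -[X in _ --> X]subr0; apply: cvgB => //; exact: cvg_cst.
  apply: (@le_trans _ _ (q * shell_mass p N / carrier_pi p origin)%:E).
    rewrite lee_fin shE -[leRHS]mulrA [carrier_pi p origin * _]mulrC mulfK ?gt_eqF//.
    rewrite -mulrA ler_pM2l//; exact: prod_geom_ge.
  rewrite -(cvg_lim _ lcvg)//; apply: lee_lim; [exact: (cvgP _ lcvg)|exact: (cvgP _ hcvg)|].
  by apply: nearW => n; rewrite lee_fin ler_pdivrMr// [leRHS]mulrC; exact: lower.
Qed.
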